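(* A graph $G$ is a Sterboul--Deming graph with a perfect matching if and only if both of the following hold: (1) $|N(S)|>|S|$ for every non-empty independent set $S$ of $G$, and (2) $\mathrm{odd}(G-S)\le |S|$ for every $S\subseteq V(G)$.
   Context: All graphs are finite, undirected and simple. $N(S)$ is the set of vertices adjacent to some vertex of $S$; $\mathrm{odd}(H)$ is the number of connected components of $H$ with an odd number of vertices. Let $M$ be a matching of a graph $G$. A path (or walk) is $M$-alternating if, of any two consecutive edges, exactly one belongs to $M$; an $mm$-$M$-path is an $M$-alternating path whose first and last edges are in $M$. An $M$-blossom is an odd cycle of length $2k+1$ with exactly $k$ edges in $M$; its base is the unique vertex of the cycle not covered by those $k$ edges. An $M$-Tflower consists of an $M$-blossom together with an $M$-stem, i.e. an $M$-alternating path of even length (possibly zero) connecting the base of the blossom to a vertex not saturated by $M$ in $G$, where the base is the only common vertex of the blossom and the stem. An $M$-Tposy consists of two $M$-blossoms joined by an $mm$-$M$-path whose endpoints are the bases of the two blossoms, such that no internal vertex of the path lies in the blossoms and the intersection of the two blossoms is either empty or an $mm$-$M$-path. Define $SD(G)$ as the set of vertices $v$ of $G$ for which there is a maximum matching $M$ of $G$ such that $v$ lies in an $M$-Tflower or an $M$-Tposy, and $KE(G)=V(G)\setminus SD(G)$. A graph $G$ is a Sterboul--Deming graph if $KE(G)=\emptyset$. *)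

(* Defs.v *)
From mathcomp Require Import all_boot.
From mathcomp Require Import boolp.

Set Implicit Arguments.
Unset Strict Implicit.
Unset Printing Implicit Defensive.

Record sgraph := SGraph {
  vertex :> finType;
  adj : rel vertex;
  adj_sym : symmetric adj;
  adj_irrefl : irreflexive adj }.

Section Graph.
Variable G : sgraph.
Implicit Types (S : {set G}) (M : {set {set G}}) (x y v b : G) (p c : seq G).

Definition nbhd S : {set G} := [set v | [exists u in S, adj u v]].

Definition independent S : bool := [forall x in S, forall y in S, ~~ adj x y].

Definition edges : {set {set G}} := [set [set x; y] | x in G, y in adj x].

(* The set of vertices saturated by [M] is [cover M]. *)
Definition matching M : bool := (M \subset edges) && trivIset M.

Definition maximum_matching M : bool :=
  matching M && [forall N : {set {set G}}, matching N ==> (#|N| <= #|M|)].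

Definition perfect_matching M : bool := matching M && (cover M == setT).

(* The path with vertex sequence [x :: p] is represented by [x] and [p]; its
   length is [size p]. *)
Definition spath x p : bool := path (@adj G) x p && uniq (x :: p).

Definition path_edges x p : seq {set G} :=
  pairmap (fun y z => [set y; z]) x p.

Definition alternating_path M x p : bool :=
  spath x p &&
  sorted (fun f g : {set G} => (f \in M) (+) (g \in M)) (path_edges x p).

(* The default value [set0] is never an element of a matching, so an mm-path
   has at least one edge. *)
Definition mm_path M x p : bool :=
  [&& alternating_path M x p, p != [::],
      head set0 (path_edges x p) \in M & last set0 (path_edges x p) \in M].

Definition cycle_edges c : {set {set G}} := [set [set y; next c y] | y in c].

(* [c] lists the vertices of the odd cycle in cyclic order, starting anywhere;
   [b] is the base. *)
Definition blossom M c b : bool :=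
  [&& cycle (@adj G) c, uniq c, 2 < size c, odd (size c),
      #|cycle_edges c :&: M| == (size c)./2,
      b \in c & b \notin cover (cycle_edges c :&: M)].

Definition stem M b p : bool :=
  [&& alternating_path M b p, ~~ odd (size p) & last b p \notin cover M].

Definition tflower M c b p : Prop :=
  [/\ blossom M c b,
      stem M b p
    & forall y, y \in b :: p -> y \in c -> y = b].

(* The intersection of two cycles, as subgraphs (common vertices and common
   edges), is an mm-path. *)
Definition meet_in_mm_path M c1 c2 : Prop :=
  exists x p, [/\ mm_path M x p,
    [set y in c1] :&: [set y in c2] = [set y in x :: p]
    & cycle_edges c1 :&: cycle_edges c2 = [set f in path_edges x p]].

Definition tposy M c1 b1 c2 b2 p : Prop :=
  [/\ blossom M c1 b1,
      blossom M c2 b2,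
      mm_path M b1 p /\ last b1 p = b2,
      forall y, y \in b1 :: p -> y != b1 -> y != b2 ->
        (y \notin c1) && (y \notin c2)
    & [disjoint c1 & c2] \/ meet_in_mm_path M c1 c2].

Definition in_tflower M v : Prop :=
  exists c b p, tflower M c b p /\ ((v \in c) || (v \in b :: p)).

Definition in_tposy M v : Prop :=
  exists c1 b1 c2 b2 p, tposy M c1 b1 c2 b2 p /\
    [|| v \in c1, v \in c2 | v \in b1 :: p].

Definition SD : {set G} :=
  [set v | `[< exists2 M, maximum_matching M & in_tflower M v \/ in_tposy M v >]].

Definition KE : {set G} := ~: SD.

Definition sterboul_deming : Prop := KE = set0.

Definition has_perfect_matching : Prop := exists M, perfect_matching M.

Definition components : {set {set G}} :=
  equivalence_partition (connect (@adj G)) [set: G].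

Definition odd_comp : nat := #|[set C in components | odd #|C|]|.

End Graph.

Section Delete.
Variables (G : sgraph) (S : {set G}).

Definition del_adj : rel {x : G | x \notin S} := fun x y => adj (val x) (val y).

Fact del_adj_sym : symmetric del_adj.
Proof. by move=> x y; apply: adj_sym. Qed.

Fact del_adj_irrefl : irreflexive del_adj.
Proof. by move=> x; apply: adj_irrefl. Qed.

Definition del_vertices : sgraph := SGraph del_adj_sym del_adj_irrefl.

End Delete.

(* Main.v *)
(** A perfect matching is a fixed-point-free involution [f] with [x] adjacent
    to [f x].  The alternating walks are the paths of the digraph [x -> y] iff
    [x] is adjacent to [f y], which is skew-symmetric: [x -> y] iff
    [f y -> f x].

    If [S] is independent, non-empty and [#|N(S)| <= #|S|], then every perfect
    matching maps [S] onto [N(S)]; propagating membership in [S] and [N(S)]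
    along a blossom and along an mm-path shows that no Tposy meets [S].

    Conversely, the set of vertices reachable from [v] violates (1) if it is
    independent, and by skew symmetry [v] and [f v] then reach each other.
    Consider a subgraph that is minimal with this property for some perfect
    matching.  If no alternating cycle passes through [v], walks from [v] to
    [f v] and back fold up into two disjoint blossoms joined by an mm-path
    through [v].  Otherwise let [A] and [B] be the colour classes of such a
    cycle [C]; walks outside [C] join two vertices of [A] and two vertices of
    [B].  If the two pairs of ends do not cross on [C], or if the two walks
    meet, then an edge of [C] is superfluous, possibly after switching the
    matching along [C], against minimality.  Two disjoint crossing walks form
    with [C] an even subdivision of K4, which is a Tposy.

    Condition (2) gives a perfect matching by Tutte's theorem, obtained from
    Gallai's lemma on the graph minus a maximal set [S] whose deletion lowers
    the matching number by [#|S|]. *)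

Require Import Defs.
From mathcomp Require Import all_boot.
From mathcomp Require Import boolp zify.

Set Implicit Arguments.
Unset Strict Implicit.
Unset Printing Implicit Defensive.

(* [count_mem] with a fixed form of its implicit arguments, so that equal
   multiplicities are syntactically equal for [nat_lia]. *)
Definition mult (T : finType) (x : T) (l : seq T) : nat := count_mem x l.

Ltac nat_lia :=
  repeat match goal with |- context [nat_of_bool ?b] => generalize (nat_of_bool b) end;
  repeat match goal with |- context [mult ?x ?s] => generalize (mult x s) end;
  clear; lia.

(** * Alternating walks as paths of a digraph *)

Section Zigzag.
Variables (T : finType) (h : rel T) (f : T -> T).
Hypotheses (hC : symmetric h) (fK : involutive f) (hf : forall x, h x (f x)).

Definition astep : rel T := fun x y => h x (f y).

Lemma astep_skew x y : astep (f x) (f y) = astep y x.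
Proof. by rewrite /astep fK hC. Qed.

(** Skew-symmetry for whole paths: the mates of the vertices of a path, taken in reverse order, form
    a path again. *)
Lemma path_astep_rev x p :
  path astep (f (last x p)) (map f (rev (belast x p))) = path astep x p.
Proof.
rewrite path_map rev_path; apply: eq_path => y z /=; exact: astep_skew.
Qed.

Lemma last_astep_rev x p : last (f (last x p)) (map f (rev (belast x p))) = f x.
Proof. by rewrite last_map; case: p => //= y p; rewrite rev_cons last_rcons. Qed.

Lemma connect_astep_rev x y : connect astep x y -> connect astep (f y) (f x).
Proof.
case/connectP=> p xp ->; apply/connectP.
exists (map f (rev (belast x p))); first by rewrite path_astep_rev.
by rewrite last_astep_rev.
Qed.

(** Restores the matching edges: a digraph path from [x] along [l] becomes the alternating walk from
    [x] along [zigzag l]. The condition [uniq (zigzag l)] says that no matching edge is visited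
    twice. *)
Fixpoint zigzag (l : seq T) : seq T :=
  if l is x :: l' then f x :: x :: zigzag l' else [::].

Lemma zigzag_cat l1 l2 : zigzag (l1 ++ l2) = zigzag l1 ++ zigzag l2.
Proof. by elim: l1 => //= x l1 ->. Qed.

Lemma zigzag_rcons l x : zigzag (rcons l x) = rcons (rcons (zigzag l) (f x)) x.
Proof. by rewrite -cats1 zigzag_cat /= -!cats1 -catA. Qed.

Lemma size_zigzag l : size (zigzag l) = (size l).*2.
Proof. by elim: l => //= x l ->. Qed.

Lemma mem_zigzag x l : (x \in zigzag l) = (x \in l) || (f x \in l).
Proof.
elim: l => //= y l IHl; rewrite !inE IHl (inv_eq fK).
by case: (x == f y); case: (x == y); rewrite /= ?orbT.
Qed.

Lemma mem_zigzag_f x l : (f x \in zigzag l) = (x \in zigzag l).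
Proof. by rewrite !mem_zigzag fK orbC. Qed.

Lemma rev_zigzag l : rev (zigzag l) = zigzag (rev (map f l)).
Proof.
elim: l => //= x l IHl.
by rewrite !rev_cons zigzag_rcons fK IHl.
Qed.

Lemma perm_zigzag l : perm_eq (zigzag l) (l ++ map f l).
Proof.
elim: l => //= x l IHl; apply/permP => P; move/permP: IHl => /(_ P).
by rewrite /= !count_cat /= => ->; lia.
Qed.

Lemma mult_nil (x : T) : mult x [::] = 0. Proof. by []. Qed.

Lemma mult_cons (x y : T) l : mult x (y :: l) = (y == x) + mult x l.
Proof. by []. Qed.

Lemma mult_cat (x : T) l1 l2 : mult x (l1 ++ l2) = mult x l1 + mult x l2.
Proof. exact: count_cat. Qed.

Lemma mult_rcons (x : T) l y : mult x (rcons l y) = mult x l + (y == x).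
Proof. by rewrite -cats1 mult_cat mult_cons addn0. Qed.

Lemma mult_rev (x : T) l : mult x (rev l) = mult x l.
Proof. exact: count_rev. Qed.

Lemma mult_mapf (x : T) l : mult x (map f l) = mult (f x) l.
Proof. by rewrite /mult count_map; apply: eq_count => y /=; rewrite (inv_eq fK). Qed.

Lemma mult_zigzag (x : T) l : mult x (zigzag l) = mult x l + mult (f x) l.
Proof.
elim: l => [|y l IHl] //; rewrite [zigzag _]/= !mult_cons (inv_eq fK) IHl.
by nat_lia.
Qed.

Definition mult_simpl :=
  (mult_nil, mult_cons, mult_cat, mult_rcons, mult_rev, mult_mapf, fK, inv_eq fK).

(** The sum [mult x l + mult (f x) l] counts the visits of [l] to the matching edge of [x].
    Distinctness of matching edges in rearranged lists thus becomes linear arithmetic. *)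
Lemma uniq_zigzag_le l1 l2 :
  (forall x, mult x l1 + mult (f x) l1 <= mult x l2 + mult (f x) l2) ->
  uniq (zigzag l2) -> uniq (zigzag l1).
Proof.
move=> le12 U2; apply: count_mem_uniq => x; apply/eqP.
have := le12 x; rewrite -!mult_zigzag /mult (count_uniq_mem _ U2).
rewrite -[x \in zigzag l1]has_pred1 has_count; case: (count_mem x _) => [|[|n]] //.
by case: (x \in zigzag l2).
Qed.

Lemma path_zigzag x l : path astep x l -> path h x (zigzag l).
Proof.
elim: l x => //= y l IHl x /andP[xy yl].
by rewrite [h x _]xy hC hf IHl.
Qed.

Lemma last_zigzag x l : last x (zigzag l) = last x l.
Proof. by elim: l x => //= y l IHl x. Qed.

End Zigzag.

Lemma next_cat (T : eqType) (p q : seq T) y z :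
  uniq (p ++ y :: z :: q) -> next (p ++ y :: z :: q) y = z.
Proof.
move=> U; have := next_rot (size p) U; rewrite rot_size_cat => <- /=.
by rewrite eqxx.
Qed.

(** * Tposies from digraph paths *)

Section CycleEdges.
Variable G : sgraph.
Implicit Types (x y z : G) (p q c : seq G).

Lemma mem_path_edges x q e :
  reflect (exists q1 q2 y z, x :: q = q1 ++ y :: z :: q2 /\ e = [set y; z])
          (e \in path_edges x q).
Proof.
elim: q x => [|w q IHq] x /=.
  by constructor=> -[[|? [|? ?]] [? [? [? []]]]].
rewrite -/(path_edges w q) inE; apply: (iffP orP).
  case=> [/eqP->|/IHq[q1 [q2 [y [z [-> ->]]]]]]; first by exists [::], q, x, w.
  by exists (x :: q1), q2, y, z.
case=> -[|x' q1] [q2 [y [z []]]]; first by case=> -> -> _ ->; left.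
by case=> _ E eE; right; apply/IHq; exists q1, q2, y, z.
Qed.

(** The remainder [p ++ r] must be non-empty: otherwise the closing edge of the cycle joins two
    vertices of the segment and need not be one of its edges. *)
Lemma cycle_edges_segment p x q r e :
  uniq (p ++ (x :: q) ++ r) -> p ++ r != [::] ->
  (e \in path_edges x q) =
  (e \in cycle_edges (p ++ (x :: q) ++ r)) && (e \subset x :: q).
Proof.
move=> U pr; apply/mem_path_edges/andP.
  case=> q1 [q2 [y [z [E ->]]]]; split; last first.
    by rewrite E; apply/subsetP=> u /set2P[] ->; rewrite mem_cat !inE eqxx ?orbT.
  rewrite E -catA /= catA in U *; apply/imsetP; exists y; last by rewrite next_cat.
  by rewrite mem_cat mem_head orbT.
case=> /imsetP[y _ ->] /subsetP sub.
have := sub _ (set21 _ _); have := sub _ (set22 _ _) => nq yq.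
have [q1 [q2 E]] : exists q1 q2, x :: q = q1 ++ y :: q2.
  by case/splitPr: yq => q1 q2; exists q1, q2.
case: q2 E => [|z q2] E; last first.
  exists q1, q2, y, z; split=> //.
  by rewrite E -catA /= catA in U *; rewrite next_cat.
(* Here [y] is the last vertex of the segment, so its successor lies in the remainder, against
   [nq]. *)
have := next_rot (size (p ++ q1)) U.
have -> : p ++ (x :: q) ++ r = (p ++ q1) ++ y :: r by rewrite E -!catA.
rewrite rot_size_cat /= => nE.
have nrp : next (p ++ (x :: q) ++ r) y \in r ++ p.
  rewrite E -!catA /= catA -nE.
  case: (r) pr => [|w r'] /=; last by rewrite eqxx mem_head.
  by rewrite cats0; case: (p) => //= w p' _; rewrite eqxx mem_head.
have := U; rewrite uniq_catCA -catA cat_uniq => /and3P[_ /hasPn H _].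
rewrite mem_cat orbC -mem_cat in nrp.
by have := H _ nrp; rewrite /= nq.
Qed.

Lemma cycle_edges_subset c e : e \in cycle_edges c -> e \subset c.
Proof.
by case/imsetP=> y yc ->; apply/subsetP=> z /set2P[]->; rewrite ?mem_next.
Qed.

Lemma cycle_edges_rev c : uniq c -> cycle_edges (rev c) = cycle_edges c.
Proof.
move=> U; apply/setP=> e; apply/imsetP/imsetP=> -[y yc ->].
  rewrite mem_rev in yc; exists (prev c y); first by rewrite mem_prev.
  by rewrite next_rev // next_prev // setUC.
exists (next c y); first by rewrite mem_rev mem_next.
by rewrite next_rev // prev_next // setUC.
Qed.

End CycleEdges.

Section Matching.
Variables (G : sgraph) (f : G -> G).
Hypotheses (fK : involutive f) (fadj : forall x, adj x (f x)).
Local Notation D := (astep (@adj G) f).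

Definition mate_edges : {set {set G}} := [set [set x; f x] | x in G].
Local Notation M := mate_edges.

Lemma mate_neq x : f x != x.
Proof. by apply/eqP=> fx; have := fadj x; rewrite fx adj_irrefl. Qed.

Lemma set2_eq (x y z t : G) :
  [set x; y] = [set z; t] -> x = z /\ y = t \/ x = t /\ y = z.
Proof.
move=> E; have := set21 z t; have := set22 z t; rewrite -{1 2}E.
have := set21 x y; have := set22 x y; rewrite {1 2}E.
move=> /set2P a /set2P b /set2P c /set2P d; intuition congruence.
Qed.

Lemma mem_mate_edges x y : ([set x; y] \in M) = (y == f x).
Proof.
apply/imsetP/eqP => [[z _ /set2_eq[] [-> ->]]|->]; rewrite ?fK //.
by exists x.
Qed.

Lemma mate_edges_matching : matching M.
Proof.
apply/andP; split.
  apply/subsetP=> _ /imsetP[x _ ->]; apply/imset2P.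
  by exists x (f x); rewrite ?inE //; apply: fadj.
apply/trivIsetP=> _ _ /imsetP[x _ ->] /imsetP[y _ ->] xy.
rewrite -setI_eq0; apply: contraNT xy => /set0Pn[z].
have imE u : z \in [set u; f u] -> [set u; f u] = [set z; f z].
  by case/set2P=> ->; rewrite // fK setUC.
by case/setIP=> /imE-> /imE->.
Qed.

Lemma mate_edges_cover : cover M = setT.
Proof.
apply/setP=> x; rewrite inE; apply/bigcupP.
by exists [set x; f x]; [exact: imset_f | exact: set21].
Qed.

Lemma mate_edges_perfect : perfect_matching M.
Proof. by rewrite /perfect_matching mate_edges_matching mate_edges_cover /=. Qed.

(** The mate of [b] is off the cycle, so only the pairs [f x, x] with [x] in [l] contribute matching
    edges. *)
Lemma cycle_edges_zigzag b l :
  path D b l -> uniq (zigzag f (b :: l)) ->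
  cycle_edges (b :: zigzag f l) :&: M = [set [set x; f x] | x in l].
Proof.
move=> bl U; have /andP[Ub U'] := U; set c := b :: _ in U' *.
apply/setP=> e; rewrite inE; apply/andP/imsetP.
  case=> /imsetP[y cy ->]; rewrite mem_mate_edges => /eqP nE.
  have : y \in zigzag f l.
    move: cy; rewrite inE => /orP[/eqP yb|//].
    have : next c y \in c by rewrite mem_next yb mem_head.
    by rewrite nE yb => /(negP Ub).
  rewrite mem_zigzag // nE => /orP[yl|fyl]; first by exists y.
  by exists (f y); rewrite // fK setUC.
case=> x xl ->; split; last by rewrite mem_mate_edges.
apply/imsetP; exists (f x); first by rewrite inE mem_zigzag_f ?mem_zigzag ?xl ?orbT.
have cE : c = (b :: zigzag f (take (index x l) l)) ++
    f x :: x :: zigzag f (drop (index x l).+1 l).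
  rewrite /c -[in LHS](cat_take_drop (index x l) l) zigzag_cat.
  by rewrite (drop_nth x) ?index_mem // nth_index.
rewrite cE next_cat; first exact: setUC.
by rewrite -cE.
Qed.

Lemma zigzag_pairs_uniq l :
  uniq (zigzag f l) -> uniq l /\ {in l, forall x, f x \notin l}.
Proof.
rewrite (perm_uniq (perm_zigzag f l)) cat_uniq => /and3P[-> /hasPn H _].
by split=> // x xl; apply: contraL xl => fxl; rewrite -[x]fK H ?map_f.
Qed.

(** A digraph step to [f b] only uses an edge to [f (f b) = b], so a path from [b] to [f b] closes
    up at [b] into a cycle with [2 * size l + 1] vertices. *)
Lemma blossom_zigzag b l :
  path D b (rcons l (f b)) -> uniq (zigzag f (b :: l)) ->
  blossom M (b :: zigzag f l) b.
Proof.
rewrite rcons_path => /andP[bl lb] U.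
have l0 : l != [::] by case: (l) lb => //=; rewrite /astep fK adj_irrefl.
have /andP[_ U'] : (f b \notin b :: zigzag f l) && uniq (b :: zigzag f l) by [].
have /andP[bNl Ul] : (b \notin zigzag f l) && uniq (zigzag f l) by [].
have [lU lN] := zigzag_pairs_uniq Ul.
have hsym := @adj_sym G.
apply/and5P; split=> //.
- rewrite /= rcons_path path_zigzag // last_zigzag.
  by move: lb; rewrite /astep fK.
- by rewrite /= size_zigzag; case: (l) l0.
- by rewrite /= size_zigzag odd_double.
rewrite cycle_edges_zigzag //= size_zigzag uphalf_double mem_head.
apply/and3P; split=> //.
  rewrite card_in_imset; first by rewrite (card_uniqP lU).
  move=> x y xl yl /set2_eq[] [] // xy _.
  by have := lN y yl; rewrite -xy xl.
apply/bigcupP=> -[_ /imsetP[x xl ->]] /set2P[] E.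
  by rewrite mem_zigzag // E xl in bNl.
by rewrite mem_zigzag // E fK xl orbT in bNl.
Qed.

Lemma path_edges_zigzag x l (e := path_edges (f x) (x :: zigzag f l)) :
  path D x l -> uniq (zigzag f (x :: l)) ->
  [/\ sorted (fun f g : {set G} => (f \in M) (+) (g \in M)) e,
      head set0 e \in M & last set0 e \in M].
Proof.
rewrite {}/e; elim: l x => [|y l IHl] x.
  by rewrite /= mem_mate_edges fK eqxx.
move=> /= /andP[xy yl] U.
have /and3P[_ U1 U2] := U.
have [S1 S2 S3] := IHl y yl U2.
split.
- move: S1 S2; rewrite /= => -> /=; rewrite !mem_mate_edges !fK !eqxx andbT.
  rewrite (inj_eq (inv_inj fK)) eq_sym; move: U1.
  by rewrite !inE !negb_or => /and3P[_ /negPf-> _].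
- by rewrite /= mem_mate_edges fK.
by move: S3 => /=.
Qed.

Lemma mm_path_zigzag x l :
  path D x l -> uniq (zigzag f (x :: l)) -> mm_path M (f x) (x :: zigzag f l).
Proof.
move=> xl U; have [S1 S2 S3] := path_edges_zigzag xl U.
have U' : uniq (f x :: x :: zigzag f l) by [].
apply/and4P; split=> //; rewrite /alternating_path S1 andbT /spath U' andbT /=.
rewrite path_zigzag //; last exact: adj_sym.
by rewrite adj_sym fadj.
Qed.

Lemma zigzag_disjoint l1 l2 x :
  uniq (zigzag f (l1 ++ l2)) -> x \in zigzag f l1 -> x \notin zigzag f l2.
Proof.
rewrite zigzag_cat cat_uniq => /and3P[_ /hasPn H _] xl1.
by apply/negP=> /H; rewrite /= xl1.
Qed.

Local Notation cntE := (mult_simpl fK).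

(** The path [q] closes into a blossom at [b] and [l2] into one at [b2]; [f b :: l1] expands to the
    mm-path [b, f b, ..., b2] between the bases. *)
Lemma in_tposy_barbell b q l1 l2 (b2 := last (f b) l1) :
  path D b (rcons q (f b)) -> path D (f b) (l1 ++ rcons l2 (f b2)) ->
  uniq (zigzag f (q ++ (f b :: l1) ++ l2)) ->
  forall x, x \in zigzag f ((f b :: l1) ++ l2) -> in_tposy M x.
Proof.
move=> bq; rewrite cat_path => /andP[bl1 bl2] U x xz.
have U1 : uniq (zigzag f (b :: q)).
  by apply: (uniq_zigzag_le fK) U => y; rewrite ?cntE; nat_lia.
have [l lE] : exists l, f b :: l1 = rcons l b2.
  by exists (belast (f b) l1); rewrite -lastI.
have U2 : uniq (zigzag f (b2 :: l2)).
  apply: uniq_zigzag_le U => // y.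
  by rewrite lE ?cntE; nat_lia.
have Up : uniq (zigzag f (f b :: l1)).
  by apply: uniq_zigzag_le U => // y; rewrite ?cntE; nat_lia.
have Uqp y : y \in zigzag f (f b :: l1) -> (y \notin zigzag f q) && (y \notin zigzag f l2).
  move=> yl; apply/andP; split; apply: (@zigzag_disjoint (f b :: l1)) yl;
    by apply: uniq_zigzag_le U => // z; rewrite ?cntE; nat_lia.
have b2l : b2 \in zigzag f (f b :: l1) by rewrite mem_zigzag // mem_last.
have bl : b \in zigzag f (f b :: l1) by rewrite mem_zigzag // mem_head orbT.
exists (b :: zigzag f q), b, (b2 :: zigzag f l2), b2, (f b :: zigzag f l1).
split; last first.
  move: xz; rewrite zigzag_cat mem_cat /= fK => /orP[->|]; first by rewrite !orbT.
  by rewrite [x \in b2 :: _]inE => ->; rewrite !orbT.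
split.
- exact: blossom_zigzag.
- exact: blossom_zigzag.
- split; last by rewrite /= last_zigzag.
  by rewrite -{1}[b]fK; apply: mm_path_zigzag.
- move=> y; rewrite -{1}[b]fK -/(zigzag f (f b :: l1)) => /Uqp/andP[yq yl2] yb yb2.
  by rewrite !inE !negb_or yb yb2 yq.
left; rewrite disjoint_has; apply/hasPn=> y; rewrite /= !inE negb_or.
have /andP[bq' bl2'] := Uqp _ bl; have /andP[b2q' b2l2'] := Uqp _ b2l.
case/orP=> [/eqP->|yq]; rewrite ?bl2' ?andbT.
  apply/eqP=> bb2; have [_ H] := zigzag_pairs_uniq Up.
  by have := H b2 (mem_last _ _); rewrite -bb2 mem_head.
apply/andP; split; first by apply: contraNneq b2q' => <-.
apply: (zigzag_disjoint (l1 := q) (l2 := l2)) yq.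
by apply: uniq_zigzag_le U => // z; rewrite ?cntE; nat_lia.
Qed.

Lemma mem_zigzag_rev x l : (x \in zigzag f (map f (rev l))) = (x \in zigzag f l).
Proof. by rewrite map_rev -rev_zigzag // mem_rev. Qed.

(** The cycle passes through the branch vertices [f a1], [t], [f a3], [s] in this order; the chord
    [xs] joins [s] to [t], and [ys] joins [f a1] to [f a3]. The blossom based at [s] consists of
    [xs] and the arc from [t] back through [f a1] to [s]; the one based at [f a3] consists of [ys]
    reversed and the arc from [f a1] through [t] to [f a3]. They share the segment from [f a1] to
    [t], and the arc between [f a3] and [s] joins the bases. *)
Lemma in_tposy_K4 c0 a1 c1 c2 a3 c3 xs ys (t := last a1 c1) (s := last a3 c3) :
  path D s (c0 ++ (a1 :: c1) ++ c2 ++ a3 :: c3) ->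
  path D s (rcons xs (f t)) -> path D (f a1) (rcons ys a3) ->
  uniq (zigzag f (c0 ++ (a1 :: c1) ++ c2 ++ (a3 :: c3) ++ xs ++ ys)) ->
  forall x, x \in zigzag f (c0 ++ (a1 :: c1) ++ c2 ++ (a3 :: c3) ++ xs ++ ys) ->
  in_tposy M x.
Proof.
move=> sc sx ay U x xz.
have PE := path_astep_rev (@adj_sym G) fK.
have [l3 l3E] : exists l3, rev (a3 :: c3) = s :: l3.
  by rewrite lastI rev_rcons -/s; exists (rev (belast a3 c3)).
have c3E y : (s == y) + mult y l3 = (a3 == y) + mult y c3.
  by rewrite -!mult_cons -l3E mult_rev.
pose l1 := xs ++ map f (rev (c0 ++ a1 :: c1)).
pose l2 := map f (rev ys) ++ (a1 :: c1) ++ c2.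
have /and4P[Ds01 Dm D12 D3] : [&& path D s (c0 ++ a1 :: c1), path D a1 c1,
    path D a1 (c1 ++ rcons c2 a3) & path D a3 c3].
  move: sc; rewrite -cat_rcons catA cat_path => /andP[Ds01].
  rewrite last_cat /= -/t cat_path last_rcons => /andP[tc2 D3].
  have Dm : path D a1 c1 by move: Ds01; rewrite cat_path => /andP[_ /andP[]].
  by apply/and4P; split=> //; rewrite cat_path Dm tc2.
have P1 : path D s (rcons l1 (f s)).
  move: sx; rewrite rcons_path => /andP[sx xt].
  rewrite /l1 rcons_cat -map_rcons -rev_cons cat_path sx lastI rev_rcons /=.
  by have := Ds01; rewrite -PE last_cat /= -/t xt.
have P2 : path D (f a3) (rcons l2 (f (f a3))).
  move: ay; rewrite -PE last_rcons belast_rcons rev_cons map_rcons fK => ay.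
  by rewrite fK /l2 !rcons_cat /= -cat_rcons cat_path ay last_rcons D12.
have [Pp lp] : path D (f s) (map f l3) /\ last (f s) (map f l3) = f a3.
  have l3E' : l3 = rev (belast a3 c3) by move: l3E; rewrite lastI rev_rcons => -[].
  rewrite l3E' PE; split=> //; exact: last_astep_rev.
have U1 : uniq (zigzag f (s :: l1)).
  apply: uniq_zigzag_le U => // y.
  by rewrite ?cntE -!c3E ?cntE; nat_lia.
have U2 : uniq (zigzag f (f a3 :: l2)).
  by apply: uniq_zigzag_le U => // y; rewrite ?cntE; nat_lia.
have Up : uniq (zigzag f (f s :: map f l3)).
  apply: uniq_zigzag_le U => // y; rewrite ?cntE -!c3E.
  by rewrite ?cntE; nat_lia.
have Um : uniq (zigzag f (a1 :: c1)).
  by apply: uniq_zigzag_le U => // y; rewrite ?cntE; nat_lia.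
have Np y : y \in zigzag f (f s :: map f l3) ->
  (y \notin zigzag f l1) && (y \notin zigzag f l2).
  move=> yl; apply/andP; split;
    [apply: (zigzag_disjoint (l2 := l1)) yl | apply: (zigzag_disjoint (l2 := l2)) yl];
    apply: uniq_zigzag_le U => // z; rewrite ?cntE -!c3E;
    by rewrite ?cntE; nat_lia.
have Nm y : y \in zigzag f l1 -> y \in zigzag f l2 -> y \in zigzag f (a1 :: c1).
  rewrite /l1 /l2 !zigzag_cat !mem_cat !mem_zigzag_rev !zigzag_cat !mem_cat.
  case: (y \in zigzag f (a1 :: c1)); first by [].
  rewrite !orbF /= -!mem_cat -!zigzag_cat => y1 y2.
  suff: y \notin zigzag f (ys ++ c2) by rewrite y2.
  apply: (zigzag_disjoint (l1 := xs ++ c0)) y1; apply: uniq_zigzag_le U => // z.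
  by rewrite ?cntE; nat_lia.
exists (s :: zigzag f l1), s, (f a3 :: zigzag f l2), (f a3), (f s :: zigzag f (map f l3)).
split; last first.
  have -> : (x \in [:: s, f s & zigzag f (map f l3)]) = (x \in zigzag f (a3 :: c3)).
    by rewrite -{1}[s]fK -[RHS]mem_zigzag_rev l3E.
  rewrite ![x \in _ :: zigzag f _]in_cons.
  move: xz; rewrite /l1 /l2 !zigzag_cat !mem_cat !mem_zigzag_rev !zigzag_cat !mem_cat.
  by do 5![case/orP => [->|]; rewrite ?orbT //] => ->; rewrite ?orbT.
split.
- exact: blossom_zigzag.
- exact: blossom_zigzag.
- split; last by rewrite /= last_zigzag.
  by rewrite -{1}[s]fK; apply: mm_path_zigzag.
- move=> y; rewrite -{1}[s]fK -/(zigzag f (f s :: map f l3)) => /Np/andP[yq yl2] yb yb2.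
  by rewrite !inE !negb_or yb yb2 yq.
have capE : [set y in s :: zigzag f l1] :&: [set y in f a3 :: zigzag f l2] =
    [set y in f a1 :: a1 :: zigzag f c1].
  have /andP[_ sNl2] : (s \notin zigzag f l1) && (s \notin zigzag f l2).
    by apply: Np; rewrite mem_zigzag // mem_head orbT.
  have a3l : f a3 \in f s :: map f l3 by rewrite -lp mem_last.
  have /andP[a3Nl1 _] : (f a3 \notin zigzag f l1) && (f a3 \notin zigzag f l2).
    by apply: Np; rewrite mem_zigzag // a3l.
  have sNa3 : s != f a3.
    have [_ /(_ _ (mem_head _ _))] := zigzag_pairs_uniq Up.
    by rewrite fK; apply: contraNneq => E; rewrite {1}E.
  apply/setP=> y; rewrite in_setI !in_set; apply/andP/idP => [[]|ym].
    rewrite in_cons => /predU1P[->|y1]; rewrite in_cons => /predU1P[y2|y2].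
    - by rewrite -y2 eqxx in sNa3.
    - by case/negP: sNl2.
    - by case/negP: a3Nl1; rewrite -y2.
    exact: Nm.
  split; rewrite in_cons; apply/orP; right.
    by rewrite /l1 zigzag_cat mem_cat mem_zigzag_rev zigzag_cat mem_cat ym !orbT.
  by rewrite /l2 !zigzag_cat !mem_cat ym !orbT.
right; exists (f a1), (a1 :: zigzag f c1); split.
- exact: mm_path_zigzag.
- exact: capE.
apply/setP=> e; rewrite in_setI in_set.
(* Reversed, the first cycle runs through the common segment in the same direction as the second, so
   [cycle_edges_segment] applies to both. *)
rewrite -[in LHS](cycle_edges_rev (c := s :: zigzag f l1)); last first.
  by case/andP: U1.
have c1E : rev (s :: zigzag f l1) = zigzag f c0 ++ (f a1 :: a1 :: zigzag f c1)
    ++ rcons (zigzag f (map f (rev xs))) s.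
  rewrite rev_cons rev_zigzag // -map_rev /l1 rev_cat map_cat -map_rev revK (mapK fK).
  by rewrite zigzag_cat [zigzag f (c0 ++ _)]zigzag_cat -catA rcons_cat rcons_cat.
have c2E : f a3 :: zigzag f l2 = (f a3 :: zigzag f (map f (rev ys))) ++
   (f a1 :: a1 :: zigzag f c1) ++ zigzag f c2.
  by rewrite /l2 zigzag_cat [zigzag f ((a1 :: c1) ++ c2)]zigzag_cat.
have /andP[_ V1] : (f s \notin s :: zigzag f l1) && uniq (s :: zigzag f l1) by [].
have /andP[_ V2] : (f (f a3) \notin f a3 :: zigzag f l2) && uniq (f a3 :: zigzag f l2) by [].
rewrite -rev_uniq c1E in V1; rewrite c2E in V2.
have S1 := cycle_edges_segment e V1; have S2 := cycle_edges_segment e V2.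
rewrite -c1E in S1; rewrite -c2E in S2.
apply/andP/idP => [[e1 e2]|ee]; last first.
  move: (ee) (ee); rewrite {1}S1; last by rewrite -size_eq0 size_cat size_rcons addnS.
  by rewrite S2 // => /andP[-> _] /andP[-> _].
rewrite S2 // e2 /=; apply/subsetP=> z ze.
have /setP/(_ z) := capE; rewrite in_setI !in_set => <-.
rewrite (subsetP (cycle_edges_subset e2) z ze) andbT.
by rewrite -mem_rev (subsetP (cycle_edges_subset e1) z ze).
Qed.

End Matching.

(** * Vertices on no alternating cycle *)

Section Walks.
Variables (G : sgraph) (h : rel G) (f : G -> G).
Hypotheses (hC : symmetric h) (hG : subrel h (@adj G)).
Hypotheses (fK : involutive f) (hf : forall x, h x (f x)).
Local Notation D := (astep h f).
Local Notation M := (mate_edges f).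

Local Notation cntE := (mult_simpl fK).

Let fadj x : adj x (f x).
Proof. exact: hG. Qed.

(** Stops at the first vertex [y] of [p] whose matching edge is already used by [A] or by an earlier
    vertex of [p]; [x] guarantees that there is one. *)
Lemma first_hit A p x :
  uniq (zigzag f A) -> x \in p -> x \in zigzag f A ->
  exists ys y r, [/\ p = ys ++ y :: r, uniq (zigzag f (A ++ ys))
                   & y \in zigzag f (A ++ ys)].
Proof.
elim: p A => //= y p IHp A UA; case: (boolP (y \in zigzag f A)) => [yA _ _|yA].
  by exists [::], y, p; rewrite cats0.
rewrite inE => /predU1P[->|xp xA]; first by rewrite (negPf yA).
have [|||ys [z [r [-> U zA]]]] := IHp (rcons A y); rewrite ?zigzag_rcons //.
- rewrite !rcons_uniq mem_rcons inE mem_zigzag_f // (negPf yA) UA.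
  by rewrite orbF eq_sym mate_neq.
- by rewrite mem_rcons in_cons mem_rcons in_cons xA !orbT.
by exists (y :: ys), z, r; split; rewrite -?[A ++ y :: ys]cat_rcons.
Qed.

(** Up to its first repeated matching edge, the walk from [v] to [f v] is a path from [v] to some
    [b] followed by a blossom at [b]. From [f b], the reversed path leads to [f v], and the walk
    from [f v] to [v] continues it up to its own first repetition. This closes a second blossom, or
    else an alternating cycle through [v]. *)
Lemma in_tposy_no_cycle v :
  connect D v (f v) -> connect D (f v) v ->
  (forall c, cycle D c -> uniq (zigzag f c) -> 1 < size c -> v \notin zigzag f c) ->
  in_tposy M v.
Proof.
move=> /connectP[p0 vp0]; case/shortenP: vp0 => p vp Up _ E1 {p0}.
move=> /connectP[p0 vp0]; case/shortenP: vp0 => p' vp' Up' _ E2 {p0} acyc.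
have DA : subrel D (astep (@adj G) f) by move=> x y; apply: hG.
have PE := path_astep_rev hC fK.
have v1 : uniq (zigzag f [:: v]) by rewrite /= inE mate_neq.
have [||q [y [r [pE Uq yq]]]] := first_hit (p := p) (x := f v) v1;
  [|exact: mem_head|].
  have := mem_last v p; rewrite -E1 inE => /orP[/eqP fv|//].
  by have := mate_neq fadj v; rewrite fv eqxx.
have {}Uq : uniq (zigzag f (v :: q)) := Uq.
(* The path [p] repeats no vertex, so it is the mate of [y] that was visited before. *)
have {yq} fyq : f y \in v :: q.
  move: yq; rewrite mem_zigzag // => /orP[yq|//].
  by move: Up; rewrite pE -cat_cons cat_uniq /= yq andbF.
have {vp Up} vq : path D v (rcons q y).
  by move: vp; rewrite pE -cat_rcons cat_path => /andP[].
case/splitPl: fyq Uq vq pE => s q2 sE Uq; rewrite rcons_cat cat_path => /andP[vs].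
rewrite sE -[y]fK; set b := f y in sE *; rewrite {1}fK => bq2 _.
pose l := map f (rev (belast v s)).
have bl : path D (f b) l by rewrite /l -sE PE.
have lv : last (f b) l = f v by rewrite /l -sE; apply: last_astep_rev.
have lE : f b :: l = map f (rev (v :: s)) by rewrite (lastI v s) rev_rcons sE.
have [||ys [z [r' [p'E Uys zA]]]] := first_hit (p := p') (x := v) Uq;
  [|by rewrite mem_zigzag // mem_head|].
  have := mem_last (f v) p'; rewrite -E2 inE => /orP[/eqP fv|//].
  by have := mate_neq fadj v; rewrite -fv eqxx.
have fvz : path D (f v) (rcons ys z).
  by move: vp'; rewrite p'E -cat_rcons cat_path => /andP[].
have zN : z \notin f v :: ys.
  move: Up'; rewrite p'E -[_ :: ys ++ _]cat_cons cat_uniq => /and3P[_ + _].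
  by rewrite /= negb_or => /andP[].
(* From [f z], the mates of [ys] in reverse order lead back to [v]. *)
have cyc w : path D v w -> last v w = f z -> w != [::] ->
    uniq (zigzag f (v :: w ++ ys)) -> in_tposy M v.
  move=> vw wz w0 U.
  have := acyc (v :: w ++ map f (rev ys)); rewrite mem_zigzag // mem_head => H.
  suff: false by []; apply: H => //.
  - move: fvz; rewrite -PE last_rcons belast_rcons rev_cons map_rcons fK => fvz.
    by rewrite /= rcons_cat cat_path vw wz.
  - by apply: (uniq_zigzag_le fK) U => x; rewrite ?cntE; nat_lia.
  by case: (w) w0.
(* If the mate of [z] lies on the reversed path or its continuation, the second blossom has base
   [f z]. *)
have [fzL|fzL] := boolP (f z \in f b :: l ++ ys).
  have blys : path D (f b) (rcons (l ++ ys) z) by rewrite rcons_cat cat_path bl lv.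
  have [l1 [l2 [lysE l1z]]] : exists l1 l2, l ++ ys = l1 ++ l2 /\ last (f b) l1 = f z.
    by case/splitPl: fzL => l1 l2 <-; exists l1, l2.
  move: blys; rewrite lysE rcons_cat -[z]fK -l1z => blys.
  have fvL : f v \in (f b :: l1) ++ l2 by rewrite /= -lysE -lv -cat_cons mem_cat mem_last.
  apply: (in_tposy_barbell fK fadj (b := b) (q := q2) (l1 := l1) (l2 := l2)).
  - exact: (sub_path DA) bq2.
  - exact: (sub_path DA) blys.
  - rewrite /= -lysE -cat_cons lE; apply: (uniq_zigzag_le fK) Uys => x.
    by rewrite ?cntE; nat_lia.
  by rewrite mem_zigzag // fvL orbT.
have {fzL} [fzs fzys] : z \notin v :: s /\ f z \notin ys.
  move: fzL; rewrite -cat_cons mem_cat lE negb_or => /andP[fzs ->]; split=> //.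
  by apply: contra fzs => zs; rewrite map_f // mem_rev.
have fzv : f z != v by apply: contraNneq zN => <-; rewrite fK mem_head.
have vq2 : path D v (s ++ q2).
  by move: bq2; rewrite cat_path vs sE rcons_path => /andP[].
have [fzq|fzq] := boolP (f z \in s ++ q2).
  have [w [w' [wE wz]]] : exists w w', s ++ q2 = w ++ w' /\ last v w = f z.
    have : f z \in v :: s ++ q2 by rewrite inE fzq orbT.
    by case/splitPl => w w' <-; exists w, w'.
  move: vq2; rewrite wE cat_path => /andP[vw _].
  apply: (cyc w) => //.
    by apply: contra_eq_neq wz => -> /=; rewrite eq_sym.
  by apply: (uniq_zigzag_le fK) Uys => x; rewrite wE ?cntE; nat_lia.
(* Now [z] itself lies on the blossom; traversing the blossom in the opposite direction reaches
   [f z]. *)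
have zq2 : z \in q2.
  move: zA; rewrite zigzag_cat mem_cat !mem_zigzag // => /orP[/orP[]|/orP[]].
  - by rewrite -[v :: _]/((v :: s) ++ q2) mem_cat (negPf fzs).
  - by rewrite inE (negPf fzv) (negPf fzq).
  - by move: zN; rewrite inE negb_or => /andP[_ /negPf->].
  - by rewrite (negPf fzys).
case/splitPr: zq2 Uys bq2 {vq2 fzq zA Uq} => qa qb Uys.
rewrite -PE last_rcons fK belast_rcons rev_cons map_rcons rev_cat rev_cons.
rewrite rcons_path map_cat map_rcons cat_path => /andP[/andP[bqb _] _].
apply: (cyc (s ++ rcons (map f (rev qb)) (f z))).
- by rewrite cat_path vs sE.
- by rewrite last_cat last_rcons.
- by rewrite -size_eq0 size_cat size_rcons addnS.
by apply: (uniq_zigzag_le fK) Uys => x; rewrite ?cntE; nat_lia.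
Qed.

End Walks.

(** * Links outside an alternating cycle *)

Section CyclicIndex.
Variables (T : eqType) (c1 c2 : seq T) (t : T).
Let c := c1 ++ t :: c2.
Let c' := rev c1 ++ rev c2 ++ [:: t].
Hypothesis U : uniq c.

Lemma index_rev_rot x : x \in c1 -> index x c' = (size c1).-1 - index x c1.
Proof.
move=> xc1; rewrite /c' index_cat mem_rev xc1.
have : uniq c1 by move: U; rewrite /c cat_uniq => /andP[].
case/splitPr: xc1 => p q Upq.
have /and3P[_ /norP[xp _] /andP[xq _]] : [&& uniq p, ~~ has (mem p) (x :: q) & uniq (x :: q)].
  by rewrite -cat_uniq.
have xp' : x \notin p := xp.
rewrite rev_cat rev_cons cat_rcons !index_cat mem_rev (negPf xq) (negPf xp') /= eqxx.
by rewrite size_rev size_cat /=; lia.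
Qed.

Lemma index_rev_rot_last : index (last t c2) c' = size c1.
Proof.
have := U; rewrite /c /c' index_cat mem_rev size_rev cat_uniq => /and3P[_ N _].
have lN : last t c2 \notin c1.
  by move/hasPn: N; apply; apply: mem_last.
rewrite (negPf lN); case/lastP: (c2) => [|s x] /=; first by rewrite eqxx addn0.
by rewrite last_rcons rev_rcons /= eqxx addn0.
Qed.

(** Switching pairs a vertex of [B] with the predecessor of its old mate. Hence, on reversal,
    positions of [B] are shifted by one against those of [A], as in [index_rev_rot]. *)
Lemma index_rev_rot_prev x : x \in c -> index x c <= size c1 ->
  index (prev c x) c' = size c1 - index x c.
Proof.
move=> xc; have [x' [l cE]] : exists x' l, c = x' :: l.
  by rewrite /c; case: (c1) => [|? ?]; do 2!eexists.
have -> : prev c x = nth x' c (index x l) by rewrite cE prev_nth -cE xc.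
(* The predecessor of the first vertex wraps around to the last vertex of [c], which comes right
   after [rev c1] in [c']. *)
have [<-|xx'] := eqVneq x' x.
  have /andP[x'l _] : (x' \notin l) && uniq l by move: U; rewrite cE.
  rewrite (memNindex x'l) => _; rewrite [in RHS]cE /= eqxx subn0 cE -last_nth.
  have -> : last x' l = last t c2 by rewrite -[RHS](last_cat x' c1 (t :: c2)) -/c cE.
  exact: index_rev_rot_last.
have -> : index x c = (index x l).+1 by rewrite cE /= (negPf xx').
move=> lt; rewrite /c nth_cat lt index_rev_rot ?mem_nth //.
rewrite index_uniq //; first by lia.
by move: U; rewrite /c cat_uniq => /andP[].
Qed.

Lemma index_rot x : x \in c ->
  index x (c2 ++ c1 ++ [:: t]) =
  if index x c <= size c1 then size c2 + index x c else index x c - (size c1).+1.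
Proof.
have := U; rewrite /c cat_uniq => /and3P[_ /hasPn N /andP[tc2 _]].
rewrite mem_cat inE => xc; rewrite !index_cat; case: (boolP (x \in c1)) xc => [xc1 _|xc1 /= xc].
  have xc2 : x \notin c2.
    by apply/negP=> xc2; have := N x; rewrite inE xc2 orbT /= xc1 => /(_ isT).
  by rewrite (negPf xc2) ltnW // index_mem.
rewrite eq_sym; case: eqVneq xc => [->|xt /= xc2].
  by rewrite (negPf tc2) addn0 leqnn.
by rewrite xc2 ifF; lia.
Qed.

End CyclicIndex.

(** * Links, and deletion of an edge of the cycle *)

Section Links.
Variables (T : finType) (h : rel T) (A B : {set T}).
Hypothesis hC : symmetric h.
Implicit Types (f : T -> T) (s t u r x y p q : T).

(** Every edge of the alternating cycle, matching or not, joins the two colour classes. The edges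
    kept here are therefore unaffected by deleting an edge of the cycle. *)
Definition cross_free : rel T := fun x y =>
  h x y && ~~ ((x \in A) && (y \in B) || (x \in B) && (y \in A)).

(* [A] and [B] are the colour classes of an alternating cycle; a link joins two
   vertices of the cycle by an alternating walk with non-matching end edges and
   all inner vertices outside the cycle, so it does not change when the matching
   is switched along the cycle. *)
Definition outer_step f : rel T := fun x y =>
  cross_free x (f y) && (y \notin A :|: B).

Definition link f s t : bool :=
  [exists y, connect (outer_step f) s y && cross_free y t].

Definition remove_edge p q : rel T := fun x y =>
  h x y && ~~ ((x == p) && (y == q) || (x == q) && (y == p)).

Lemma cross_freeC : symmetric cross_free.
Proof.
by move=> x y; rewrite /cross_free hC orbC ![(y \in _) && _]andbC.
Qed.

Lemma remove_edgeC p q : symmetric (remove_edge p q).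
Proof.
by move=> x y; rewrite /remove_edge hC orbC ![(y == _) && _]andbC.
Qed.

Lemma sub_remove_edge p q : subrel (remove_edge p q) h.
Proof. by move=> x y /andP[]. Qed.

Lemma cross_free_remove_edge p q :
  p \in A -> q \in B -> subrel cross_free (remove_edge p q).
Proof.
move=> pA qB x y /andP[hxy] N; rewrite /remove_edge hxy /=.
apply: contra N => /orP[] /andP[/eqP-> /eqP->].
  by rewrite pA qB.
by rewrite pA qB orbT.
Qed.

Lemma eq_link f f' : {in ~: (A :|: B), f =1 f'} -> link f =2 link f'.
Proof.
move=> ff' s t; apply: eq_existsb => y; congr (_ && _).
apply: eq_connect => x z; rewrite /outer_step.
by case: (boolP (z \in A :|: B)) => zAB; rewrite ?andbF // ff' // inE.
Qed.

Lemma link_remove_edge f p q s t : involutive f -> p \in A -> q \in B ->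
  link f s t -> connect (astep (remove_edge p q) f) s (f t).
Proof.
move=> fK pA qB /existsP[y /andP[sy yt]].
apply: (@connect_trans _ _ y); last first.
  by apply: connect1; rewrite /astep fK; apply: cross_free_remove_edge yt.
apply: connect_sub sy => x z /andP[xz _]; apply: connect1.
exact: cross_free_remove_edge xz.
Qed.

Section Involution.
Variable f : T -> T.
Hypotheses (fK : involutive f) (fAB : forall x, (f x \in A :|: B) = (x \in A :|: B)).

Lemma outer_step_rev x y : x \notin A :|: B -> outer_step f x y ->
  outer_step f (f y) (f x).
Proof.
move=> xAB /andP[xy yAB]; rewrite /outer_step fK fAB xAB.
by rewrite cross_freeC xy.
Qed.

(** All steps but the first reverse by skew-symmetry; the first one leaves the cycle vertex [s], and
    its reversal is only an edge to [s]. *)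
Lemma connect_outer_rev s y : s \in A :|: B -> y \notin A :|: B ->
  connect (outer_step f) s y ->
  exists2 z, connect (outer_step f) (f y) z & cross_free z s.
Proof.
move=> sAB yAB /connectP[p]; elim/last_ind: p y yAB => [|p x IHp] y yAB.
  by move=> _ ys; rewrite ys /= sAB in yAB.
rewrite rcons_path last_rcons => /andP[sp px] yx; subst y.
have [lAB|lAB] := boolP (last s p \in A :|: B); last first.
  have [z z1 z2] := IHp _ lAB sp erefl; exists z => //.
  by apply: connect_trans z1; apply: connect1; apply: outer_step_rev.
have ls : last s p = s.
  case/lastP: p sp lAB {IHp px} => // p z; rewrite rcons_path last_rcons.
  by case/andP=> _ /andP[_ /negPf->].
exists (f x) => //; rewrite cross_freeC.
by move: px; rewrite ls => /andP[].
Qed.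

Lemma link_sym s t : s \in A :|: B -> t \in A :|: B -> link f s t -> link f t s.
Proof.
move=> sAB tAB /existsP[y /andP[sy yt]]; apply/existsP.
have [yAB|yAB] := boolP (y \in A :|: B).
  suff ys : y = s by exists t; rewrite connect0 cross_freeC -ys.
  case/connectP: sy => p; case/lastP: p => [//|p z]; rewrite rcons_path last_rcons.
  by move=> /andP[_ /andP[_ zAB]] yz; rewrite yz (negPf zAB) in yAB.
have [z z1 z2] := connect_outer_rev sAB yAB sy.
exists z; rewrite z2 andbT; apply: connect_trans z1; apply: connect1.
by rewrite /outer_step fK cross_freeC yt fAB.
Qed.

End Involution.

(** Only every other vertex of the cycle is listed in [c], namely those of [A]; the full cycle is
    [zigzag f c]. *)
Definition alt_cycle f c : Prop :=
  [/\ involutive f, forall x, h x (f x), cycle (astep h f) c,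
      uniq (zigzag f c) & (A =i c) /\ (B =i map f c)].

(* The position on the cycle of the matching edge that contains [x]. *)
Definition pair_index f c x : nat := if x \in c then index x c else index (f x) c.

Section Cycle.
Variables (f : T -> T) (c : seq T).
Hypothesis fc : alt_cycle f c.

Let fK : involutive f. Proof. by case: fc. Qed.
Let hf x : h x (f x). Proof. by case: fc. Qed.
Let cD : cycle (astep h f) c. Proof. by case: fc. Qed.
Let cU : uniq (zigzag f c). Proof. by case: fc. Qed.
Let Ac : A =i c. Proof. by case: fc => _ _ _ _ []. Qed.
Let Bc : B =i map f c. Proof. by case: fc => _ _ _ _ []. Qed.

Lemma alt_cycle_memB x : (x \in B) = (f x \in A).
Proof. by rewrite Ac Bc -[x in LHS]fK (mem_map (inv_inj fK)). Qed.

Lemma alt_cycle_memA x : (x \in A) = (f x \in B).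
Proof. by rewrite alt_cycle_memB fK. Qed.

Lemma alt_cycle_fAB x : (f x \in A :|: B) = (x \in A :|: B).
Proof. by rewrite !inE -alt_cycle_memB -alt_cycle_memA orbC. Qed.

Lemma alt_cycle_uniq : uniq c.
Proof. by move: cU; rewrite (perm_uniq (perm_zigzag f c)) cat_uniq => /andP[]. Qed.

Lemma alt_cycle_disjoint x : x \in A -> x \notin B.
Proof.
rewrite Ac Bc; move: cU; rewrite (perm_uniq (perm_zigzag f c)) cat_uniq.
by case/and3P=> _ /hasPn N _ xc; apply/negP => /N /=; rewrite xc.
Qed.

Lemma pair_indexA x : x \in A -> pair_index f c x = index x c.
Proof. by rewrite Ac /pair_index => ->. Qed.

Lemma pair_indexB x : x \in B -> pair_index f c x = index (f x) c.
Proof.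
by rewrite /pair_index -Ac; case: ifP => // /alt_cycle_disjoint /negPf->.
Qed.

Lemma pair_index_f x : x \in A :|: B -> pair_index f c (f x) = pair_index f c x.
Proof.
rewrite inE => /orP[] xAB.
  by rewrite (pair_indexA xAB) pair_indexB -?alt_cycle_memA // fK.
by rewrite (pair_indexB xAB) pair_indexA // -alt_cycle_memB.
Qed.

Lemma pair_index_size x : x \in A :|: B -> pair_index f c x < size c.
Proof.
rewrite inE => /orP[] xAB.
  by rewrite pair_indexA // index_mem -Ac.
by rewrite pair_indexB // index_mem -Ac -alt_cycle_memB.
Qed.

(* Without the edge between [s] and [f x0], vertices of [A] are traversed only
   upwards and vertices of [B] only downwards in the order of [c]. *)
Section Remove.
Variables (x0 : T) (p : seq T).
Hypothesis cE : c = x0 :: p.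
Let s := last x0 p.
Let D' := astep (remove_edge s (f x0)) f.

Let sA : s \in A. Proof. by rewrite Ac cE mem_last. Qed.
Let x0A : x0 \in A. Proof. by rewrite Ac cE mem_head. Qed.
Let fx0B : f x0 \in B. Proof. by rewrite -alt_cycle_memA. Qed.

(** The deleted edge only realises the closing step from [s] to [x0]. *)
Lemma sorted_remove_edge : sorted D' c.
Proof.
have U := alt_cycle_uniq.
have : path (astep h f) x0 p.
  by move: cD; rewrite cE /= rcons_path => /andP[].
move/(pathP x0) => H; rewrite cE; apply/(pathP x0) => i ip.
rewrite /D' /astep /remove_edge (inj_eq (inv_inj fK)) [h _ _]H //= negb_or.
apply/andP; split; rewrite negb_and.
  move: U; rewrite cE => /andP[+ _]; apply: contraR => /norP[_ /negPn/eqP<-].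
  exact: mem_nth.
apply/orP; left; apply: contraTneq fx0B => <-; apply: alt_cycle_disjoint.
by rewrite Ac cE mem_nth //= ltnW.
Qed.

Lemma remove_edge_up x y : x \in A -> y \in A ->
  pair_index f c x <= pair_index f c y -> connect D' x y.
Proof.
move=> xA yA; rewrite !pair_indexA // => le.
have S : sorted (connect D') c.
  by apply: sub_sorted sorted_remove_edge => ? ?; apply: connect1.
have := sorted_leq_nth (@connect_trans _ D') (@connect0 _ D') x0 S.
move=> /(_ (index x c) (index y c)); rewrite !inE !index_mem -!Ac => /(_ xA yA le).
by rewrite !nth_index // -Ac.
Qed.

Lemma remove_edge_down x y : x \in B -> y \in B ->
  pair_index f c x <= pair_index f c y -> connect D' y x.
Proof.
move=> xB yB le.
have fxA : f x \in A by rewrite -alt_cycle_memB.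
have fyA : f y \in A by rewrite -alt_cycle_memB.
have AB z : z \in B -> z \in A :|: B by rewrite inE orbC => ->.
have := remove_edge_up fxA fyA; rewrite !pair_index_f ?AB // => /(_ le).
by move/(connect_astep_rev (remove_edgeC _ _) fK); rewrite !fK.
Qed.

Lemma pair_index_last : pair_index f c s = (size c).-1.
Proof. by rewrite pair_indexA // /s cE index_last // -cE alt_cycle_uniq. Qed.

Lemma pair_index_le_last x : x \in A :|: B -> pair_index f c x <= pair_index f c s.
Proof. by move/pair_index_size; rewrite pair_index_last; case: (size c). Qed.

(** From [a] go up to [s], over the first link to [f t], down to [r], over the second link to [f u],
    up to [t], over the first link to [f s] and down to [f a]. The way back uses the second link,
    the first and the second again. *)
Lemma remove_edge_noncrossing t u r a :
  t \in A -> u \in B -> r \in B -> a \in A ->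
  link f s t -> link f u r ->
  pair_index f c u <= pair_index f c t -> pair_index f c r <= pair_index f c t ->
  pair_index f c u <= pair_index f c a ->
  connect D' a (f a) /\ connect D' (f a) a.
Proof.
have AAB z : z \in A -> z \in A :|: B by rewrite inE => ->.
have BAB z : z \in B -> z \in A :|: B by rewrite inE orbC => ->.
have fA z : z \in B -> f z \in A by rewrite alt_cycle_memB.
have fB z : z \in A -> f z \in B by rewrite alt_cycle_memA.
move=> tA uB rB aA st ur ut rt ua.
have ts := link_sym fK alt_cycle_fAB (AAB _ sA) (AAB _ tA) st.
have ru := link_sym fK alt_cycle_fAB (BAB _ uB) (BAB _ rB) ur.
have L x y := @link_remove_edge f s (f x0) x y fK sA fx0B.
have st' := L _ _ st; have ts' := L _ _ ts.
have ur' := L _ _ ur; have ru' := L _ _ ru.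
have up x y : x \in A -> y \in A -> pair_index f c x <= pair_index f c y -> connect D' x y.
  exact: remove_edge_up.
have dn x y : x \in B -> y \in B -> pair_index f c x <= pair_index f c y -> connect D' y x.
  exact: remove_edge_down.
have T' x y z : connect D' x y -> connect D' y z -> connect D' x z.
  exact: connect_trans.
have lst x : x \in A :|: B -> pair_index f c x <= pair_index f c s.
  exact: pair_index_le_last.
have P x : x \in A :|: B -> pair_index f c (f x) = pair_index f c x.
  exact: pair_index_f.
split.
  apply: (T' _ s); first by rewrite up ?lst ?AAB.
  apply: (T' _ _ _ st'); apply: (T' _ r); first by rewrite dn ?fB ?P ?AAB.
  apply: (T' _ _ _ ru'); apply: (T' _ t); first by rewrite up ?fA ?P ?BAB.
  by apply: (T' _ _ _ ts'); rewrite dn ?fB ?P ?lst ?AAB.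
apply: (T' _ u); first by rewrite dn ?fB ?P ?AAB.
apply: (T' _ _ _ ur'); apply: (T' _ t); first by rewrite up ?fA ?P ?BAB.
apply: (T' _ _ _ ts'); apply: (T' _ r); first by rewrite dn ?fB ?P ?lst // ?(AAB _ sA) ?BAB.
by apply: (T' _ _ _ ru'); rewrite up ?fA ?P ?BAB.
Qed.

(** The additional link between [s] and [r] is used both ways: out over it to [f r], up to [t] and
    over the link to [f s]; back over its reverse from [r] to [f s], down to [u] and over the link
    to [f r]. *)
Lemma remove_edge_crossing t u r a :
  t \in A -> u \in B -> r \in B -> a \in A ->
  link f s t -> link f u r -> link f s r ->
  pair_index f c r <= pair_index f c t -> pair_index f c t < pair_index f c u ->
  pair_index f c r <= pair_index f c a ->
  connect D' a (f a) /\ connect D' (f a) a.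
Proof.
have AAB z : z \in A -> z \in A :|: B by rewrite inE => ->.
have BAB z : z \in B -> z \in A :|: B by rewrite inE orbC => ->.
have fA z : z \in B -> f z \in A by rewrite alt_cycle_memB.
have fB z : z \in A -> f z \in B by rewrite alt_cycle_memA.
move=> tA uB rB aA st ur sr rt tu ra.
have ts := link_sym fK alt_cycle_fAB (AAB _ sA) (AAB _ tA) st.
have rs := link_sym fK alt_cycle_fAB (AAB _ sA) (BAB _ rB) sr.
have L x y := @link_remove_edge f s (f x0) x y fK sA fx0B.
have ts' := L _ _ ts; have ur' := L _ _ ur.
have sr' := L _ _ sr; have rs' := L _ _ rs.
have up x y : x \in A -> y \in A -> pair_index f c x <= pair_index f c y -> connect D' x y.
  exact: remove_edge_up.
have dn x y : x \in B -> y \in B -> pair_index f c x <= pair_index f c y -> connect D' y x.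
  exact: remove_edge_down.
have T' x y z : connect D' x y -> connect D' y z -> connect D' x z.
  exact: connect_trans.
have lst x : x \in A :|: B -> pair_index f c x <= pair_index f c s.
  exact: pair_index_le_last.
have P x : x \in A :|: B -> pair_index f c (f x) = pair_index f c x.
  exact: pair_index_f.
split.
  apply: (T' _ s); first by rewrite up ?lst ?AAB.
  apply: (T' _ _ _ sr'); apply: (T' _ t); first by rewrite up ?fA ?P ?BAB.
  by apply: (T' _ _ _ ts'); rewrite dn ?fB ?P ?lst ?AAB.
apply: (T' _ r); first by rewrite dn ?fB ?P ?AAB.
apply: (T' _ _ _ rs'); apply: (T' _ u); first by rewrite dn ?fB ?P ?lst // ?(AAB _ sA) ?BAB.
by apply: (T' _ _ _ ur'); rewrite up ?fA ?P ?BAB.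
Qed.

End Remove.
End Cycle.
End Links.

(** * Switching the matching along an alternating cycle *)

Section Switch.
Variables (T : finType) (h : rel T) (A B : {set T}).
Hypothesis hC : symmetric h.
Implicit Types (f : T -> T) (c : seq T).

Lemma alt_cycle_rot f c1 c2 :
  alt_cycle h A B f (c1 ++ c2) -> alt_cycle h A B f (c2 ++ c1).
Proof.
case=> fK hf cD cU [Ac Bc]; split=> //.
- by rewrite -rot_size_cat rot_cycle.
- by apply: (uniq_zigzag_le fK) cU => x; rewrite ?(mult_simpl fK); nat_lia.
split=> x; first by rewrite Ac !mem_cat orbC.
by rewrite Bc !map_cat !mem_cat orbC.
Qed.

Lemma alt_cycle_size f c : alt_cycle h A B f c -> size c = #|A|.
Proof.
move=> fc; rewrite -(card_uniqP (alt_cycle_uniq fc)); apply: eq_card => x.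
by case: fc => _ _ _ _ [-> _].
Qed.

(* For [c = a_0, ..., a_n] this pairs [a_k] with [f a_(k+1)]; the new matching
   traverses [c] backwards. *)
Definition switch f c x :=
  if x \in A then f (next c x) else if x \in B then prev c (f x) else f x.

Section AltCycle.
Variables (f : T -> T) (c : seq T).
Hypothesis fc : alt_cycle h A B f c.
Local Notation f' := (switch f c).

Let fK : involutive f. Proof. by case: fc. Qed.
Let hf x : h x (f x). Proof. by case: fc. Qed.
Let cD : cycle (astep h f) c. Proof. by case: fc. Qed.
Let Ac : A =i c. Proof. by case: fc => _ _ _ _ []. Qed.
Let cU : uniq c. Proof. exact: alt_cycle_uniq fc. Qed.
Let memB x : (x \in B) = (f x \in A). Proof. exact: alt_cycle_memB fc _. Qed.
Let ANB x : x \in A -> x \notin B. Proof. exact: alt_cycle_disjoint fc _. Qed.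

Lemma switchA x : x \in A -> f' x = f (next c x).
Proof. by rewrite /switch => ->. Qed.

Lemma switchB x : x \in B -> f' x = prev c (f x).
Proof. by move=> xB; rewrite /switch xB ifF //; apply: contraTF xB => /ANB. Qed.

Lemma switch_involutive : involutive f'.
Proof.
move=> x; have [xA|xA] := boolP (x \in A).
  rewrite (switchA xA) switchB; first by rewrite fK prev_next.
  by rewrite memB fK Ac mem_next -Ac.
have [xB|xB] := boolP (x \in B).
  rewrite (switchB xB) switchA; first by rewrite next_prev // fK.
  by rewrite Ac mem_prev -Ac -memB.
rewrite {2}/switch (negPf xA) (negPf xB) /switch -memB (negPf xB).
by rewrite memB fK (negPf xA).
Qed.

Lemma switch_edge x : h x (f' x).
Proof.
rewrite /switch; case: ifP => [xA|_].
  by have := next_cycle cD; apply; rewrite -Ac.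
case: ifP => // xB; rewrite hC.
have fxc : f x \in c by rewrite -Ac -memB.
have := next_cycle cD (_ : prev c (f x) \in c); rewrite mem_prev => /(_ fxc).
by rewrite next_prev // /astep fK.
Qed.

(** For the new matching, the digraph step from a vertex of [c] to its predecessor runs along an old
    matching edge. *)
Lemma alt_cycle_switch : alt_cycle h A B f' (rev c).
Proof.
have fK' := switch_involutive.
have Ac' : A =i rev c by move=> x; rewrite mem_rev Ac.
have Bc' : B =i map f' (rev c).
  move=> x; apply/idP/mapP => [xB|[y yc ->]].
    exists (f' x); last by rewrite fK'.
    by rewrite switchB // mem_rev mem_prev -Ac -memB.
  by rewrite mem_rev -Ac in yc; rewrite switchA // memB fK Ac mem_next -Ac.
split=> //; first exact: switch_edge.
  rewrite rev_cycle; apply: cycle_from_next => // x xc.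
  by rewrite /astep switchA ?Ac // hf.
rewrite (perm_uniq (perm_zigzag _ _)) cat_uniq (map_inj_uniq (inv_inj fK')).
rewrite rev_uniq cU andbT; apply/hasPn => x; rewrite -Bc' => xB.
by apply/negP; rewrite /= -Ac' => /ANB; rewrite xB.
Qed.

Lemma link_switch : link h A B f =2 link h A B f'.
Proof.
apply: eq_link => x; rewrite !inE negb_or => /andP[xA xB].
by rewrite /switch (negPf xA) (negPf xB).
Qed.

End AltCycle.

Section Indices.
Variables (f : T -> T) (c1 c2 : seq T) (t : T).
Let c := c1 ++ t :: c2.
Let c' := (rev c1 ++ rev c2) ++ [:: t].
Hypothesis fc : alt_cycle h A B f c.
Local Notation f' := (switch f c).

Let Ac : A =i c. Proof. by case: fc => _ _ _ _ []. Qed.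
Let cU : uniq c. Proof. exact: alt_cycle_uniq fc. Qed.

Lemma alt_cycle_switch_rot : alt_cycle h A B f' c'.
Proof.
have := alt_cycle_switch fc; rewrite rev_cat rev_cons -cats1 => /alt_cycle_rot.
by rewrite catA.
Qed.

Let fc' := alt_cycle_switch_rot.

Lemma pair_index_pivot : pair_index f c t = size c1.
Proof.
have tA : t \in A by rewrite Ac mem_cat mem_head orbT.
rewrite (pair_indexA fc tA) /c index_cat /= eqxx addn0 ifF //.
by apply/negP=> tc1; move: cU; rewrite cat_uniq /= tc1 andbF.
Qed.

Lemma pair_index_switchA x : x \in A -> pair_index f c x < size c1 ->
  pair_index f' c' x = (size c1).-1 - pair_index f c x.
Proof.
move=> xA; rewrite (pair_indexA fc' xA) (pair_indexA fc xA).
rewrite [index x c]index_cat; case: ifP => [xc1 _|_]; last by rewrite ltnNge leq_addr.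
by rewrite -(index_rev_rot cU) // catA.
Qed.

Lemma pair_index_switchB x : x \in B -> pair_index f c x <= size c1 ->
  pair_index f' c' x = size c1 - pair_index f c x.
Proof.
move=> xB; rewrite (pair_indexB fc' xB) (pair_indexB fc xB) (switchB fc xB) => le.
by rewrite -(index_rev_rot_prev cU) // ?catA // -Ac -(alt_cycle_memB fc).
Qed.

Lemma pair_index_switch_last : pair_index f' c' (last t c2) = size c1.
Proof.
rewrite (pair_indexA fc'); first by rewrite -(index_rev_rot_last cU) catA.
by rewrite Ac mem_cat mem_last orbT.
Qed.

Lemma pair_index_rot x : x \in A :|: B ->
  pair_index f (c2 ++ c1 ++ [:: t]) x =
  if pair_index f c x <= size c1 then size c2 + pair_index f c x
  else pair_index f c x - (size c1).+1.
Proof.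
have fr : alt_cycle h A B f (c2 ++ c1 ++ [:: t]).
  by have := fc; rewrite /c -cat_rcons => /alt_cycle_rot; rewrite -cats1.
rewrite inE => /orP[] xAB.
  by rewrite (pair_indexA fc xAB) (pair_indexA fr xAB) index_rot // -Ac.
rewrite (pair_indexB fc xAB) (pair_indexB fr xAB) index_rot // -Ac.
by rewrite -(alt_cycle_memB fc).
Qed.

End Indices.

(** * Positions of two links that minimality excludes *)

Section Irreducible.
Variable v : T.
Hypotheses (vAB : v \in A :|: B) (A1 : 1 < #|A|).
Hypothesis irr : forall p q f', h p q -> involutive f' ->
  (forall x, remove_edge h p q x (f' x)) ->
  connect (astep (remove_edge h p q) f') v (f' v) ->
  connect (astep (remove_edge h p q) f') (f' v) v -> False.
Local Notation link := (link h A B).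
Local Notation alt_cycle := (alt_cycle h A B).
Local Notation pi := pair_index.

(** Since the cycle has at least two matching edges, its closing edge is not one of them; so [f]
    survives the deletion and minimality applies. *)
Lemma irreducible_remove f c x0 p (s := last x0 p) a :
  alt_cycle f c -> c = x0 :: p -> a \in A -> a = v \/ a = f v ->
  connect (astep (remove_edge h s (f x0)) f) a (f a) ->
  connect (astep (remove_edge h s (f x0)) f) (f a) a -> False.
Proof.
move=> fc cE aA av c1 c2; case: (fc) => fK hf cD cU [Ac Bc].
have hsx : h s (f x0) by move: cD; rewrite cE /= rcons_path => /andP[].
have sx : s != x0.
  have := alt_cycle_uniq fc; have := A1; rewrite -(alt_cycle_size fc) cE /=.
  by rewrite /s; case: (p) => //= y q _ /andP[+ _]; apply: contraNneq => <-; apply: mem_last.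
have sA : s \in A by rewrite Ac cE mem_last.
have fxB : f x0 \in B by rewrite -(alt_cycle_memA fc) Ac cE mem_head.
have hr x : remove_edge h s (f x0) x (f x).
  rewrite /remove_edge hf (inj_eq (inv_inj fK)) /= negb_or !negb_and.
  apply/andP; split; first by case: eqVneq => //= ->.
  by case: eqVneq => //= ->; rewrite fK eq_sym.
apply: (irr hsx fK hr); first by case: av c1 c2 => ->; rewrite ?fK.
by case: av c1 c2 => ->; rewrite ?fK.
Qed.

Lemma irreducible_witness f c : alt_cycle f c ->
  exists2 a, a \in A & (a = v \/ a = f v) /\ pi f c a = pi f c v.
Proof.
move=> fc; move: (vAB); rewrite inE => /orP[vA|vB]; first by exists v; auto.
exists (f v); first by rewrite -(alt_cycle_memB fc).
by split; [right | rewrite (pair_index_f fc)].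
Qed.

Lemma head_last (d : seq T) s : exists x0 p, d ++ [:: s] = x0 :: p /\ last x0 p = s.
Proof.
case: d => [|x0 d]; first by exists s, [::].
by exists x0, (d ++ [:: s]); rewrite last_cat.
Qed.

Lemma not_noncrossing1 f c d s t u r : alt_cycle f c -> c = d ++ [:: s] ->
  t \in A -> u \in B -> r \in B -> link f s t -> link f u r ->
  pi f c u <= pi f c t -> pi f c r <= pi f c t ->
  minn (pi f c u) (pi f c r) <= pi f c v -> False.
Proof.
move=> fc cds tA uB rB st ur ut rt urv.
have [x0 [p [cE sE]]] := head_last d s; rewrite -cds in cE.
have [a aA [av aE]] := irreducible_witness fc; rewrite -aE in urv.
have fK : involutive f by case: fc.
have [ua|ua] := leqP (pi f c u) (pi f c a).
  have [|c1 c2] := remove_edge_noncrossing hC fc cE tA uB rB aA _ ur ut rt ua.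
    by rewrite sE.
  exact: irreducible_remove fc cE aA av c1 c2.
have ra : pi f c r <= pi f c a by move: urv; rewrite geq_min leqNgt ua.
have ru : link f r u.
  by apply: (link_sym hC fK (alt_cycle_fAB fc)) ur; rewrite inE ?uB ?rB orbT.
have [|c1 c2] := remove_edge_noncrossing hC fc cE tA rB uB aA _ ru rt ut ra.
  by rewrite sE.
exact: irreducible_remove fc cE aA av c1 c2.
Qed.

Lemma cycle_split f c d s t : alt_cycle f c -> c = d ++ [:: s] -> t \in A ->
  exists c1 c2, [/\ c = c1 ++ t :: c2, last t c2 = s & s \in A].
Proof.
case=> _ _ _ _ [Ac _] cE tA; have sA : s \in A by rewrite Ac cE mem_cat mem_head orbT.
have tc : t \in c by rewrite -Ac.
have [c1 [c2 cE']] : exists c1 c2, c = c1 ++ t :: c2.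
  by case/splitPr: tc => c1 c2; exists c1, c2.
exists c1, c2; split=> //; rewrite -[RHS](last_cat t d [:: s]) -cE cE'.
by rewrite last_cat.
Qed.

(** If [v] lies before both [u] and [r], switch the matching and cut the reversed cycle at [t]. This
    reverses the arc before [t]: now [v] is no longer before both [u] and [r], and these are still
    not after [s], which takes the role of [t]. *)
Lemma not_noncrossing2 f c d s t u r : alt_cycle f c -> c = d ++ [:: s] ->
  t \in A -> u \in B -> r \in B -> link f s t -> link f u r ->
  pi f c u <= pi f c t -> pi f c r <= pi f c t -> False.
Proof.
move=> fc cds tA uB rB st ur ut rt.
have [urv|urv] := leqP (minn (pi f c u) (pi f c r)) (pi f c v).
  exact: not_noncrossing1 fc cds tA uB rB st ur ut rt urv.
have fK : involutive f by case: fc.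
have [c1 [c2 [cE lt sA]]] := cycle_split fc cds tA; clear cds; subst c.
have ts : link f t s.
  by apply: (link_sym hC fK (alt_cycle_fAB fc)) st; rewrite inE ?sA ?tA.
have fc' := alt_cycle_switch_rot fc.
rewrite (pair_index_pivot fc) in ut rt.
apply: (not_noncrossing1 fc' erefl sA uB rB); rewrite -?link_switch //.
- by rewrite -lt (pair_index_switch_last fc) (pair_index_switchB fc) // leq_subr.
- by rewrite -lt (pair_index_switch_last fc) (pair_index_switchB fc) // leq_subr.
rewrite (pair_index_switchB fc uB ut) (pair_index_switchB fc rB rt).
have vt : pi f (c1 ++ t :: c2) v < size c1.
  by apply: leq_trans urv _; rewrite geq_min ut.
move: (vAB); rewrite inE => /orP[vA|vB].
  by rewrite (pair_index_switchA fc vA vt); move: urv vt; clear; lia.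
by rewrite (pair_index_switchB fc vB (ltnW vt)); move: urv vt; clear; lia.
Qed.

(** Rotating the cycle to end at [t] exchanges the roles of [s] and [t]. *)
Lemma not_noncrossing3 f c d s t u r : alt_cycle f c -> c = d ++ [:: s] ->
  t \in A -> u \in B -> r \in B -> link f s t -> link f u r ->
  pi f c t < pi f c u -> pi f c t < pi f c r -> False.
Proof.
move=> fc cds tA uB rB st ur ut rt.
have fK : involutive f by case: fc.
have [c1 [c2 [cE lt sA]]] := cycle_split fc cds tA.
have ts : link f t s.
  by apply: (link_sym hC fK (alt_cycle_fAB fc)) st; rewrite inE ?sA ?tA.
have AAB z : z \in A -> z \in A :|: B by rewrite inE => ->.
have BAB z : z \in B -> z \in A :|: B by rewrite inE orbC => ->.
have us : pi f c u <= pi f c s.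
  have [x0 [p [cE' sE]]] := head_last d s; rewrite -cds in cE'.
  by rewrite -sE (pair_index_le_last fc cE') ?BAB.
have rs : pi f c r <= pi f c s.
  have [x0 [p [cE' sE]]] := head_last d s; rewrite -cds in cE'.
  by rewrite -sE (pair_index_le_last fc cE') ?BAB.
clear cds; subst c; rewrite (pair_index_pivot fc) in ut rt.
have fc' : alt_cycle f ((c2 ++ c1) ++ [:: t]).
  by have := fc; rewrite -cat_rcons => /alt_cycle_rot; rewrite -cats1 catA.
have pi' := pair_index_rot fc.
apply: (not_noncrossing2 fc' erefl sA uB rB ts ur); rewrite -catA.
  rewrite (pi' _ (BAB _ uB)) (pi' _ (AAB _ sA)) !ifN -?ltnNge ?(leq_trans ut us) //.
  exact: leq_sub2r.
rewrite (pi' _ (BAB _ rB)) (pi' _ (AAB _ sA)) !ifN -?ltnNge ?(leq_trans rt rs) //.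
exact: leq_sub2r.
Qed.

Lemma not_crossing_linked1 f c d s t u r : alt_cycle f c -> c = d ++ [:: s] ->
  t \in A -> u \in B -> r \in B -> link f s t -> link f u r -> link f s r ->
  pi f c r <= pi f c t -> pi f c t < pi f c u -> pi f c r <= pi f c v -> False.
Proof.
move=> fc cds tA uB rB st ur sr rt tu rv.
have [x0 [p [cE sE]]] := head_last d s; rewrite -cds in cE.
have [a aA [av aE]] := irreducible_witness fc; rewrite -aE in rv.
have [||c1 c2] := remove_edge_crossing hC fc cE tA uB rB aA _ ur _ rt tu rv.
- by rewrite sE.
- by rewrite sE.
exact: irreducible_remove fc cE aA av c1 c2.
Qed.

(** If [v] lies before [r], rotating the cycle to end at [t] moves [v] behind [u]. The roles of [s]
    and [t] and of [u] and [r] are exchanged, and the link between [t] and [u] replaces the one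
    between [s] and [r]. *)
Lemma not_crossing_linked2 f c d s t u r : alt_cycle f c -> c = d ++ [:: s] ->
  t \in A -> u \in B -> r \in B -> link f s t -> link f u r ->
  link f s r -> link f t u ->
  pi f c r <= pi f c t -> pi f c t < pi f c u -> False.
Proof.
move=> fc cds tA uB rB st ur sr tu rt tu'.
have [rv|rv] := leqP (pi f c r) (pi f c v).
  exact: not_crossing_linked1 fc cds tA uB rB st ur sr rt tu' rv.
have fK : involutive f by case: fc.
have [c1 [c2 [cE lt sA]]] := cycle_split fc cds tA.
have AAB z : z \in A -> z \in A :|: B by rewrite inE => ->.
have BAB z : z \in B -> z \in A :|: B by rewrite inE orbC => ->.
have ts : link f t s.
  by apply: (link_sym hC fK (alt_cycle_fAB fc)) st; rewrite ?AAB.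
have ru : link f r u.
  by apply: (link_sym hC fK (alt_cycle_fAB fc)) ur; rewrite ?BAB.
have us : pi f c u <= pi f c s.
  have [x0 [p [cE' sE]]] := head_last d s; rewrite -cds in cE'.
  by rewrite -sE (pair_index_le_last fc cE') ?BAB.
clear cds; subst c; rewrite (pair_index_pivot fc) in rt tu'.
have fc' : alt_cycle f ((c2 ++ c1) ++ [:: t]).
  by have := fc; rewrite -cat_rcons => /alt_cycle_rot; rewrite -cats1 catA.
have us2 := pair_index_size fc (BAB _ uB); rewrite size_cat /= in us2.
have ts1 := leq_trans tu' us.
have pi' := pair_index_rot fc.
apply: (not_crossing_linked1 fc' erefl sA rB uB ts ru tu); rewrite -catA.
- rewrite (pi' _ (BAB _ uB)) (pi' _ (AAB _ sA)) !ifN -?ltnNge //.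
  exact: leq_sub2r.
- rewrite (pi' _ (AAB _ sA)) (pi' _ (BAB _ rB)) rt ifN -?ltnNge //.
  move: us2 ts1 (pair_index_size fc (AAB _ sA)); rewrite size_cat /=; clear; lia.
rewrite (pi' _ (BAB _ uB)) (pi' _ vAB) ifN -?ltnNge // (ltnW (leq_trans rv rt)).
by move: us2; clear; lia.
Qed.

(** Switching with [s] kept in last place reverses the order. The shift of [B] against [A] by one
    turns the weak inequality into the strict one and conversely, which gives the preceding case. *)
Lemma not_crossing_linked3 f c d s t u r : alt_cycle f c -> c = d ++ [:: s] ->
  t \in A -> u \in B -> r \in B -> link f s t -> link f u r ->
  link f s r -> link f t u ->
  pi f c u <= pi f c t -> pi f c t < pi f c r -> False.
Proof.
move=> fc cds tA uB rB st ur sr tu ut tr.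
have BAB z : z \in B -> z \in A :|: B by rewrite inE orbC => ->.
have AAB z : z \in A -> z \in A :|: B by rewrite inE => ->.
have us2 := pair_index_size fc (BAB _ uB).
have rs2 := pair_index_size fc (BAB _ rB).
have ts2 := pair_index_size fc (AAB _ tA).
subst c; have fc' := alt_cycle_switch_rot fc.
rewrite size_cat /= addn1 !ltnS in us2 rs2 ts2.
apply: (not_crossing_linked2 fc' erefl tA uB rB); rewrite -?link_switch //;
  rewrite (pair_index_switchA fc tA) // ?(pair_index_switchB fc) //.
all: move: ut tr us2 rs2 ts2; clear; lia.
Qed.

End Irreducible.

End Switch.

(** * Minimal subgraphs *)

Section LinkLists.
Variables (T : finType) (h : rel T) (A B : {set T}) (f : T -> T) (c : seq T).
Hypotheses (hC : symmetric h) (fc : alt_cycle h A B f c).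
Local Notation outer := (outer_step h A B f).
Local Notation free := (cross_free h A B).
Local Notation link := (link h A B f).

Let fK : involutive f. Proof. by case: fc. Qed.
Let fAB := alt_cycle_fAB fc.

Lemma path_outer s p : path outer s p -> {in p, forall x, x \notin A :|: B}.
Proof.
elim: p s => //= y p IHp s /andP[/andP[_ yAB] yp] x.
by rewrite inE => /predU1P[->//|]; apply: IHp yp x.
Qed.

Lemma connect_outer s p x : path outer s p -> x \in p ->
  connect outer s x /\ connect outer x (last s p).
Proof.
move=> sp xp; case/splitPr: xp sp => p1 p2; rewrite -cat_rcons cat_path last_cat.
case/andP=> s1; rewrite !last_rcons => s2; split; apply/connectP.
  by exists (rcons p1 x); rewrite ?last_rcons.
by exists p2.
Qed.

Lemma connect_outer_rev2 x y t : x \notin A :|: B -> connect outer x y ->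
  free y t -> connect outer t (f x).
Proof.
move=> xAB /connectP[p]; elim: p x xAB => [|z p IHp] x xAB /=.
  move=> _ -> xt; apply: connect1.
  by rewrite /outer_step fK (cross_freeC _ _ hC) xt fAB.
move=> /andP[xz zp] yE yt.
have zAB : z \notin A :|: B by case/andP: xz.
apply: connect_trans (IHp z zAB zp yE yt) _; apply: connect1.
exact: (outer_step_rev hC fK fAB).
Qed.

(** Walk from [s] to [f x], then back to [s] along the reversal of the walk from [s] to [x]. *)
Lemma link_self s x : s \in A :|: B -> x \notin A :|: B ->
  connect outer s x -> connect outer s (f x) -> link s s.
Proof.
move=> sAB xAB sx sfx; have [z xz zs] := connect_outer_rev hC fK fAB sAB xAB sx.
by apply/existsP; exists z; rewrite zs (connect_trans sfx xz).
Qed.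

(** Along the walk, an outer walk from a vertex [s] of [X] to the current vertex is maintained,
    restarting at each visit to [X]. The first step to a vertex [z] of [Y] uses an edge to [f z],
    which is in [X], and completes a link. *)
Lemma exists_link (X Y : {set T}) x y :
  [disjoint X & Y] -> A :|: B = X :|: Y -> {in Y, forall z, f z \in X} ->
  {in X &, forall z w, h z w -> free z w} ->
  x \in X -> y \in Y -> connect (astep h f) x y ->
  exists s t, [/\ s \in X, t \in X & link s t].
Proof.
move=> XY ABE fY freeX xX yY /connectP[p xp yE].
pose K z := z \in X \/ z \notin A :|: B /\ exists2 s, s \in X & connect outer s z.
have freeO z w : (z \notin A :|: B) || (w \notin A :|: B) -> h z w -> free z w.
  move=> zw hzw; rewrite /cross_free hzw /=; move: zw; rewrite !inE.
  by case: (z \in A); case: (z \in B); case: (w \in A); case: (w \in B).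
have : K x by left.
elim: p x {xX} xp yE => [|z p IHp] x /=.
  move=> _ yE [xX|[]]; last by rewrite -yE ABE inE yY orbT.
  by move/pred0P/(_ x): XY; rewrite /= xX -yE yY.
case/andP=> xz zp yE Kx.
have [s sX sx] : exists2 s, s \in X & connect outer s x.
  by case: Kx => [xX|[_ []]]; [exists x | move=> s; exists s].
have [zX|zX] := boolP (z \in X); first by apply: IHp zp yE _; left.
have [zY|zY] := boolP (z \in Y); last first.
  have zAB : z \notin A :|: B by rewrite ABE inE negb_or zX.
  apply: IHp zp yE _; right; split=> //; exists s => //.
  apply: connect_trans sx (connect1 _); rewrite /outer_step zAB andbT.
  by apply: freeO; rewrite ?fAB ?zAB ?orbT.
exists s, (f z); split; rewrite ?fY //; apply/existsP; exists x; rewrite sx /=.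
case: Kx => [xX|[xAB _]]; first by apply: freeX; rewrite ?fY.
by apply: freeO; rewrite ?xAB.
Qed.

End LinkLists.

Section Core.
Variable G : sgraph.
Implicit Types (h : rel G) (f : G -> G) (c : seq G).

Lemma uniq_zigzag_cat f (l1 l2 : seq G) : involutive f ->
  uniq (zigzag f l1) -> uniq (zigzag f l2) ->
  {in l2, forall x, x \notin zigzag f l1} -> uniq (zigzag f (l1 ++ l2)).
Proof.
move=> fK U1 U2 N; rewrite zigzag_cat cat_uniq U1 U2 andbT /=.
apply/hasPn => x; rewrite mem_zigzag // => /orP[/N //|/N].
by rewrite mem_zigzag_f.
Qed.

Lemma uniq_zigzag_nomate f (l : seq G) : involutive f -> uniq l ->
  {in l, forall x, f x \notin l} -> uniq (zigzag f l).
Proof.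
move=> fK U N; rewrite (perm_uniq (perm_zigzag f l)) cat_uniq U.
rewrite (map_inj_uniq (inv_inj fK)) U andbT.
by apply/hasPn => _ /mapP[x xl ->]; apply: N.
Qed.

(** * Crossing links *)

Section K4.
Variables (h : rel G) (f : G -> G) (A B : {set G}) (c : seq G) (v : G).
Hypotheses (hC : symmetric h) (hG : subrel h (@adj G)).
Hypotheses (fc : alt_cycle h A B f c) (vAB : v \in A :|: B) (A1 : 1 < #|A|).
Hypothesis irr : forall p q f', h p q -> involutive f' ->
  (forall x, remove_edge h p q x (f' x)) ->
  connect (astep (remove_edge h p q) f') v (f' v) ->
  connect (astep (remove_edge h p q) f') (f' v) v -> False.
Variables (d : seq G) (s t u r : G).
Hypotheses (cds : c = d ++ [:: s]) (tA : t \in A) (uB : u \in B) (rB : r \in B).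
Hypotheses (st : link h A B f s t) (ur : link h A B f u r).
Local Notation link := (link h A B f).
Local Notation outer := (outer_step h A B f).
Local Notation pi := (pair_index f c).

Let fK : involutive f. Proof. by case: fc. Qed.
Let hf x : h x (f x). Proof. by case: fc. Qed.
Let fAB := alt_cycle_fAB fc.
Let AAB z : z \in A -> z \in A :|: B. Proof. by rewrite inE => ->. Qed.
Let BAB z : z \in B -> z \in A :|: B. Proof. by rewrite inE orbC => ->. Qed.
Let sA : s \in A.
Proof. by case: fc => _ _ _ _ [-> _]; rewrite cds mem_cat mem_head orbT. Qed.

(** A link that visits both ends of a matching edge would give a link from [s] or [u] to itself,
    which is non-crossing; two links that meet would give links between the colour classes. Both are
    excluded by minimality, so cycle and links form a subdivided K4. *)
Lemma in_tposy_crossing : pi u <= pi t -> pi t < pi r -> in_tposy (mate_edges f) v.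
Proof.
move=> ut tr.
have /existsP[y /andP[/connectP[xs0 sxs0]]] := st.
case/shortenP: sxs0 => xs sxs Uxs _ yE xst {xs0}; rewrite {y}yE in xst.
have /existsP[y /andP[/connectP[ys0 uys0]]] := ur.
case/shortenP: uys0 => ys uys Uys _ yE ysr {ys0}; rewrite {y}yE in ysr.
have xsN := path_outer sxs; have ysN := path_outer uys.
have nlink_ss : ~ link s s.
  move=> ss; have su : pi u <= pi s.
    have [x0 [p [cE sE]]] := head_last d s; rewrite -cds in cE.
    by rewrite -sE (pair_index_le_last fc cE) ?BAB.
  have rs : pi r <= pi s.
    have [x0 [p [cE sE]]] := head_last d s; rewrite -cds in cE.
    by rewrite -sE (pair_index_le_last fc cE) ?BAB.
  exact: (not_noncrossing2 hC vAB A1 irr fc cds sA uB rB ss ur su rs).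
have nlink_uu : ~ link u u.
  by move=> uu; apply: (not_noncrossing2 hC vAB A1 irr fc cds tA uB uB st uu).
have xsf : {in xs, forall w, f w \notin xs}.
  move=> w wxs; apply/negP => fwxs; apply: nlink_ss.
  have [sw _] := connect_outer sxs wxs; have [sfw _] := connect_outer sxs fwxs.
  exact: (link_self hC fc (AAB sA) (xsN _ wxs) sw sfw).
have ysf : {in ys, forall w, f w \notin ys}.
  move=> w wys; apply/negP => fwys; apply: nlink_uu.
  have [uw _] := connect_outer uys wys; have [ufw _] := connect_outer uys fwys.
  exact: (link_self hC fc (BAB uB) (ysN _ wys) uw ufw).
have ru : link r u by apply: (link_sym hC fK fAB) ur; rewrite ?BAB.
have disj w : w \in xs -> w \notin zigzag f ys.
  move=> wxs; rewrite mem_zigzag //; apply/negP.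
  have [sw wt] := connect_outer sxs wxs.
  case/orP=> wys; have [uw wr] := connect_outer uys wys.
    (* At a common vertex the two links can exchange their continuations. *)
    have sr : link s r.
      by apply/existsP; exists (last u ys); rewrite (connect_trans sw wr) ysr.
    have tu : link t u.
      apply: (link_sym hC fK fAB (BAB uB) (AAB tA)).
      by apply/existsP; exists (last s xs); rewrite (connect_trans uw wt) xst.
    exact: (not_crossing_linked3 hC vAB A1 irr fc cds tA uB rB st ur sr tu ut tr).
  (* The links pass a matching edge in opposite directions, so each can continue along the reverse
     of the other. *)
  have su : link s u.
    have [z wz zu] := connect_outer_rev hC fK fAB (BAB uB) (ysN _ wys) uw.
    by apply/existsP; exists z; rewrite zu andbT (connect_trans sw) // -[w]fK.
  have tr' : link t r.
    have tfw := connect_outer_rev2 hC fc (xsN _ wxs) wt xst.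
    by apply/existsP; exists (last u ys); rewrite (connect_trans tfw wr) ysr.
  exact: (not_crossing_linked2 hC vAB A1 irr fc cds tA rB uB st ru su tr' ut tr).
have [P [Q [cE lQ _]]] := cycle_split fc cds tA.
have tP : pi t = size P by have := fc; rewrite cE => /pair_index_pivot.
have Ac : A =i c by case: fc => _ _ _ _ [].
have cPQ : c = rcons P t ++ Q by rewrite cat_rcons.
have fuP : f u \in rcons P t.
  move: ut; rewrite tP (pair_indexB fc uB) cPQ index_cat size_rcons.
  by case: ifP => // _; rewrite leqNgt ltnS leq_addr.
have frQ : f r \in Q.
  have : f r \in c by rewrite -Ac -(alt_cycle_memB fc).
  move: tr; rewrite tP (pair_indexB fc rB) cPQ index_cat mem_cat.
  by case: ifP => //; rewrite -index_mem size_rcons ltnS leqNgt => /negPf->.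
have [c0 [c1 [PE lc1]]] : exists c0 c1, rcons P t = c0 ++ f u :: c1 /\ last (f u) c1 = t.
  have [c0 [c1 PE]] : exists c0 c1, rcons P t = c0 ++ f u :: c1.
    by case/splitPr: fuP => c0 c1; exists c0, c1.
  by exists c0, c1; split=> //; rewrite -[t](last_rcons s P) PE last_cat.
have [c2 [c3 QE]] : exists c2 c3, Q = c2 ++ f r :: c3.
  by case/splitPr: frQ => c2 c3; exists c2, c3.
have lc3 : last (f r) c3 = s by move: lQ; rewrite QE last_cat.
have cE' : c = c0 ++ (f u :: c1) ++ c2 ++ f r :: c3.
  by rewrite cE -cat_rcons PE QE -catA.
have DA : subrel (astep h f) (astep (@adj G) f) by move=> x y; apply: hG.
have Dout : subrel outer (astep h f) by move=> x y /andP[/andP[]].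
have zc x : (x \in zigzag f c) = (x \in A :|: B).
  rewrite mem_zigzag // !inE (alt_cycle_memB fc).
  by rewrite !Ac.
have LE : c0 ++ (f u :: c1) ++ c2 ++ (f r :: c3) ++ xs ++ ys = c ++ xs ++ ys.
  by rewrite cE' -!catA.
(* The branch vertices [f a1] and [f a3] are [u] and [r]. *)
apply: (in_tposy_K4 fK (fun x => hG (hf x)) (c0 := c0) (a1 := f u) (c1 := c1)
         (c2 := c2) (a3 := f r) (c3 := c3) (xs := xs) (ys := ys)).
- rewrite -cE' lc3; apply: (sub_path DA).
  by case: (fc) => _ _ cD _ _; move: cD; rewrite (cycle_path s) cds last_cat.
- apply: (sub_path DA); rewrite lc3 lc1 rcons_path (sub_path Dout sxs).
  by move: xst => /andP[]; rewrite /astep fK.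
- apply: (sub_path DA); rewrite fK rcons_path (sub_path Dout uys).
  by move: ysr => /andP[]; rewrite /astep fK.
- rewrite LE; apply: (uniq_zigzag_cat fK).
  + by case: fc.
  + apply: (uniq_zigzag_cat fK).
    * by apply: (uniq_zigzag_nomate fK) xsf; case/andP: Uxs.
    * by apply: (uniq_zigzag_nomate fK) ysf; case/andP: Uys.
    move=> x xys; rewrite mem_zigzag //; apply/norP.
    by split; apply/negP=> /disj; rewrite ?mem_zigzag_f // mem_zigzag // xys.
  by move=> x; rewrite mem_cat zc => /orP[/xsN|/ysN].
by rewrite LE zigzag_cat mem_cat zc vAB.
Qed.

End K4.

(** The perfect matching is quantified existentially so that, in a minimal subgraph, deleting an
    edge is also forbidden after a switch. *)
Definition linked_vertex h v : Prop := exists f : G -> G,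
  [/\ involutive f, forall x, h x (f x),
      connect (astep h f) v (f v) & connect (astep h f) (f v) v].

Lemma in_tposy_cycle h f c v : symmetric h -> subrel h (@adj G) ->
  (forall p q, h p q -> ~ linked_vertex (remove_edge h p q) v) ->
  involutive f -> (forall x, h x (f x)) ->
  connect (astep h f) v (f v) -> connect (astep h f) (f v) v ->
  cycle (astep h f) c -> uniq (zigzag f c) -> 1 < size c -> v \in zigzag f c ->
  in_tposy (mate_edges f) v.
Proof.
move=> hC hG irr fK hf vfv fvv cD cU c1 vc.
pose A := [set x in c]; pose B := [set x in map f c].
have fc : alt_cycle h A B f c by split=> //; split=> x; rewrite inE.
have vAB : v \in A :|: B.
  move: vc; rewrite mem_zigzag // !inE => /orP[->//|fvc].
  by rewrite -[v]fK map_f ?orbT.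
have A1 : 1 < #|A| by rewrite -(alt_cycle_size fc).
have irr' p q f' : h p q -> involutive f' ->
    (forall x, remove_edge h p q x (f' x)) ->
    connect (astep (remove_edge h p q) f') v (f' v) ->
    connect (astep (remove_edge h p q) f') (f' v) v -> False.
  by move=> hpq ? ? ? ?; apply: (irr p q hpq); exists f'.
have memB := alt_cycle_memB fc; have memA := alt_cycle_memA fc.
have AB : [disjoint A & B].
  by apply/pred0P => x /=; apply/negP => /andP[/(alt_cycle_disjoint fc)/negP].
have [a [aA afa faa]] : exists a, [/\ a \in A, connect (astep h f) a (f a)
    & connect (astep h f) (f a) a].
  move: vAB; rewrite inE => /orP[vA|vB]; first by exists v.
  by exists (f v); rewrite -memB fK.
have [s [t [sA tA st]]] : exists s t, [/\ s \in A, t \in A & link h A B f s t].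
  apply: (exists_link fc AB erefl _ _ aA _ afa); rewrite -?memA //.
    by move=> z; rewrite memB.
  move=> z w zA wA hzw; rewrite /cross_free hzw zA wA.
  by rewrite !(negPf (alt_cycle_disjoint fc _)).
have [u [r [uB rB ur]]] : exists u r, [/\ u \in B, r \in B & link h A B f u r].
  apply: (exists_link fc _ (setUC A B) _ _ _ _ faa); rewrite -?memA //.
  - by rewrite disjoint_sym.
  - by move=> z; rewrite memA.
  move=> z w zB wB hzw.
  have BA x : x \in B -> (x \in A) = false.
    by move=> xB; apply: contraTF xB => /(alt_cycle_disjoint fc).
  by rewrite /cross_free hzw zB wB !BA.
have sc : s \in c by rewrite inE in sA.
have [d fds] : exists d, alt_cycle h A B f (d ++ [:: s]).
  case/splitPr: sc fc => c1' c2'; rewrite -cat_rcons => /alt_cycle_rot.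
  by rewrite -cats1 catA => ?; exists (c2' ++ c1').
have K4 := in_tposy_crossing hC hG fds vAB A1 irr' erefl tA _ _ st.
set pi := pair_index f (d ++ [:: s]) in K4.
have ru : link h A B f r u.
  apply: (link_sym hC fK (alt_cycle_fAB fc)) ur; by rewrite inE ?uB ?rB orbT.
(* The cycle ends at [s], so the links cross exactly when [t] separates the positions of [u] and
   [r]. *)
have [ut|tu] := leqP (pi u) (pi t); have [rt|tr] := leqP (pi r) (pi t).
- by case: (not_noncrossing2 hC vAB A1 irr' fds erefl tA uB rB st ur ut rt).
- exact: K4 uB rB ur ut tr.
- exact: K4 rB uB ru rt tu.
by case: (not_noncrossing3 hC vAB A1 irr' fds erefl tA uB rB st ur tu tr).
Qed.

(** Edges are deleted as long as [v] remains linked, by induction on the number of adjacent ordered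
    pairs. The resulting matching may differ from the initial one. *)
Theorem in_tposy_linked h v : symmetric h -> subrel h (@adj G) ->
  linked_vertex h v -> exists f : G -> G,
  [/\ involutive f, forall x, adj x (f x) & in_tposy (mate_edges f) v].
Proof.
move: {2}_.+1 (ltnSn #|[pred z : G * G | h z.1 z.2]|) => n.
elim: n h => // n IHn h hn hC hG [f [fK hf vfv fvv]].
have [[p [q [hpq ok]]]|irr] :=
  pselect (exists p q, h p q /\ linked_vertex (remove_edge h p q) v).
  apply: (IHn (remove_edge h p q)) ok.
  - rewrite -ltnS; apply: leq_trans hn; rewrite ltnS; apply: proper_card.
    apply/properP; split.
      by apply/subsetP=> z; rewrite !inE => /andP[].
    by exists (p, q); rewrite !inE /= ?hpq // /remove_edge !eqxx /= andbF.
  - exact: remove_edgeC.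
  - by move=> x y /sub_remove_edge/hG.
exists f; split=> //; first by move=> x; apply: hG.
have irr' p q : h p q -> ~ linked_vertex (remove_edge h p q) v.
  by move=> hpq ok; apply: irr; exists p, q.
have [[c [cD cU c1 vc]]|acyc] := pselect (exists c, [/\ cycle (astep h f) c,
    uniq (zigzag f c), 1 < size c & v \in zigzag f c]).
  exact: (in_tposy_cycle hC hG irr' fK hf vfv fvv cD cU c1 vc).
apply: (in_tposy_no_cycle hC hG fK hf vfv fvv) => c cD cU c1.
by apply/negP => vc; apply: acyc; exists c.
Qed.

End Core.

(** * Tutte's theorem *)

Lemma odd_card_involution (T : finType) (f : T -> T) (C : {set T}) :
  involutive f -> {in C, forall x, f x \in C} ->
  odd #|[set x in C | f x == x]| = odd #|C|.
Proof.
move=> fK; move: {2}_.+1 (ltnSn #|C|) => n.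
elim: n C => // n IHn C Cn fC.
have [/eqP E|/set0Pn[x]] := boolP ([set x in C | f x != x] == set0).
  congr (odd #|pred_of_set _|); apply/setP=> x; rewrite inE.
  move/setP/(_ x): E; rewrite !inE.
  by case: (x \in C) => //= /negbFE ->.
rewrite inE => /andP[xC fx].
have fxC := fC x xC.
have fxCx : f x \in C :\ x by rewrite !inE fx.
have -> : [set y in C | f y == y] = [set y in C :\ x :\ f x | f y == y].
  apply/setP=> y; rewrite !inE; have [->|yfx] /= := eqVneq y (f x).
    by rewrite fK eq_sym (negPf fx) andbF.
  by have [->|] := eqVneq y x; rewrite ?(negPf fx) ?andbF.
rewrite IHn.
- by rewrite [in RHS](cardsD1 x) [in RHS](cardsD1 (f x)) xC fxCx /= negbK.
- move: Cn; rewrite (cardsD1 x) (cardsD1 (f x)) xC fxCx; clear; lia.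
move=> y; rewrite !inE => /and3P[yfx yx yC]; rewrite fC // andbT.
by rewrite (inj_eq (inv_inj fK)) yx (inv_eq fK) yfx.
Qed.

Lemma iter_mul_fix (T : Type) (h : T -> T) (w : T) a n :
  iter a h w = w -> iter (n * a) h w = w.
Proof. by move=> aw; elim: n => // n IHn; rewrite mulSn iterD IHn. Qed.

(** * Components of the union of two matchings *)

Section Orbit.
Variables (T : finType) (f g : T -> T) (w : T).
Hypotheses (fK : involutive f) (gK : involutive g) (gw : g w = w) (fw : f w != w).
Let h := f \o g.

Let h_inj : injective h.
Proof. exact: inj_comp (inv_inj fK) (inv_inj gK). Qed.

(* [h] moves along the path by two edges, and [h^k (g (h^k w)) = w] because
   [h (g (h z)) = g z]. *)
Lemma iter_comp_fixed k : iter k h (g (iter k h w)) = w.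
Proof.
by elim: k => [|k IHk] //; rewrite iterSr iterS {2}/h /= gK /h /= fK.
Qed.

(** As [g] fixes [w], this orbit is closed under [f] and [g] separately: it is the component of [w]
    in the union of the two matchings. *)
Definition alternating_orbit : {set T} := [set z | fconnect h w z].

Lemma alternating_orbit_base : w \in alternating_orbit.
Proof. by rewrite inE connect0. Qed.

Lemma alternating_orbit_g z : z \in alternating_orbit -> g z \in alternating_orbit.
Proof.
rewrite !inE => wz; rewrite fconnect_sym //.
have := iter_comp_fixed (findex h w z); rewrite iter_findex // => E.
by rewrite -[X in fconnect _ _ X]E fconnect_iter.
Qed.

Lemma alternating_orbit_f z : z \in alternating_orbit -> f z \in alternating_orbit.
Proof.
move=> /alternating_orbit_g; rewrite !inE => wz; apply: connect_trans wz _.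
by apply: connect1; rewrite /= /h /= gK.
Qed.

(** If [f] fixes [z = f (g (iter k h w))], then [z = g (iter k h w)], and [k] further steps lead
    back to [w]. *)
Lemma alternating_orbit_fixed z : z \in alternating_orbit -> f z = z ->
  exists k, z = iter k.+1 h w /\ iter k.*2.+1 h w = w.
Proof.
rewrite inE => /iter_findex; case: (findex h w z) => [|k] /= zE fz.
  by move: fw; rewrite zE fz eqxx.
exists k; split; first by rewrite -zE.
have zg : z = g (iter k h w) by rewrite -fz -zE /h /= fK.
rewrite -addnn -iterS -addnS iterD iterS zE zg; exact: iter_comp_fixed.
Qed.

Lemma alternating_orbit_fixed_uniq x y :
  x \in alternating_orbit -> y \in alternating_orbit -> f x = x -> f y = y -> x = y.
Proof.
move=> xO yO fx fy.
have [k [-> kw]] := alternating_orbit_fixed xO fx.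
have [l [-> lw]] := alternating_orbit_fixed yO fy.
(* If [2a + 1] and [2(b + a) + 1] are periods of [w], so is their difference [2b], and hence
   [b = 2b(a + 1) - b(2a + 1)]. *)
have main a b : iter a.*2.+1 h w = w -> iter (b + a).*2.+1 h w = w -> iter b h w = w.
  move=> aw; rewrite doubleD -addnS iterD aw => b2w.
  have := iter_mul_fix a.+1 b2w.
  have -> : a.+1 * b.*2 = b + b * a.*2.+1 by lia.
  by rewrite iterD (iter_mul_fix _ aw).
have [kl|/ltnW lk] := leqP k l.
  rewrite -(subnK kl) -addnS addnC iterD; congr iter.
  by rewrite (main k) // subnK.
rewrite -(subnK lk) -addnS addnC iterD; congr iter.
by rewrite (main l) // subnK.
Qed.

End Orbit.

Section Tutte.
Variable G : sgraph.
Implicit Types (S : {set G}) (f g : {ffun G -> G}) (x y w : G).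

(** A matching of [G - S], encoded as an involution that fixes the unmatched vertices and all of
    [S]. *)
Definition avoids S f : bool :=
  [&& [forall x, f (f x) == x], [forall x, (f x == x) || adj x (f x)]
    & [forall x in S, f x == x]].

Definition fixed f : {set G} := [set x | f x == x].

Lemma avoidsP S f : reflect
  [/\ involutive f, forall x, f x = x \/ adj x (f x) & {in S, forall x, f x = x}]
  (avoids S f).
Proof.
apply: (iffP and3P) => [[/forallP fK /forallP ff /forall_inP fS]|[fK ff fS]]; split.
- by move=> x; apply/eqP.
- by move=> x; case/orP: (ff x) => [/eqP|]; [left | right].
- by move=> x /fS/eqP.
- by apply/forallP=> x; rewrite fK.
- by apply/forallP=> x; case: (ff x) => ->; rewrite ?eqxx ?orbT.
by apply/forall_inP=> x /fS->.
Qed.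

Lemma odd_fixed S f : avoids S f -> odd #|fixed f| = odd #|G|.
Proof.
case/avoidsP=> fK _ _; rewrite -cardsT -(odd_card_involution fK (C := setT)) //.
by congr (odd #|pred_of_set _|); apply/setP=> x; rewrite !inE.
Qed.

(** * Gallai's lemma for the graph minus [S] *)

Section Gallai.
Variables (S : {set G}) (k : nat).
Hypothesis kmin : forall f, avoids S f -> k <= #|fixed f|.
Hypothesis missed : forall w, w \notin S ->
  exists f, [/\ avoids S f, #|fixed f| = k & f w = w].

Lemma avoids_glue f g (O : {set G}) : avoids S f -> avoids S g ->
  {in O, forall z, f z \in O} -> {in O, forall z, g z \in O} ->
  avoids S [ffun z => if z \in O then g z else f z].
Proof.
move=> /avoidsP[fK ff fS] /avoidsP[gK gg gS] fO gO; apply/avoidsP; split.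
- move=> z; rewrite !ffunE; case: (boolP (z \in O)) => zO; first by rewrite gO ?gK.
  rewrite ifN ?fK //; apply: contra zO => /fO; by rewrite fK.
- by move=> z; rewrite ffunE; case: ifP.
by move=> z zS; rewrite ffunE; case: ifP; [rewrite gS | rewrite fS].
Qed.

Lemma card_fixed_glue f g (O : {set G}) :
  #|fixed [ffun z => if z \in O then g z else f z]| +
  #|fixed [ffun z => if z \in O then f z else g z]| = #|fixed f| + #|fixed g|.
Proof.
have E f' g' : #|fixed [ffun z => if z \in O then g' z else f' z]| =
    #|fixed g' :&: O| + #|fixed f' :\: O|.
  rewrite -(cardsID O); congr (_ + _); apply: eq_card => z; rewrite !inE ffunE.
    by case: ifP; rewrite ?andbF.
  by case: ifP.
by rewrite !E -(cardsID O (fixed f)) -(cardsID O (fixed g)); lia.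
Qed.

(* The component of [w] in the union of [f] and [g] is a path that starts in the
   [g]-fixed [w], so it cannot contain both [x] and [y]; switching from [f] to
   [g] on it keeps the number of fixed points, both being minimal. *)
Lemma exchange f x y w : avoids S f -> #|fixed f| = k -> w \notin S ->
  f x = x -> f y = y -> x != y -> f w != w ->
  exists f', [/\ avoids S f', #|fixed f'| = k, f' w = w & f' x = x \/ f' y = y].
Proof.
move=> fS fk wS fx fy xy fw; have [g [gS gk gw]] := missed wS.
have [fK _ _] := avoidsP _ _ fS; have [gK _ _] := avoidsP _ _ gS.
pose O := alternating_orbit f g w.
have fO : {in O, forall z, f z \in O}.
  by move=> z; apply: (alternating_orbit_f fK gK gw).
have gO : {in O, forall z, g z \in O}.
  by move=> z; apply: (alternating_orbit_g fK gK gw).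
pose f' := [ffun z => if z \in O then g z else f z].
pose g' := [ffun z => if z \in O then f z else g z].
have f'S : avoids S f' by apply: avoids_glue.
have g'S : avoids S g' by apply: avoids_glue.
have := card_fixed_glue f g O; rewrite -/f' -/g' fk gk => fg.
exists f'; split=> //.
- by have := kmin f'S; have := kmin g'S; move: fg; clear; lia.
- by rewrite ffunE alternating_orbit_base.
have [xO|xO] := boolP (x \in O); last by left; rewrite ffunE (negPf xO).
right; rewrite ffunE ifN //; apply: contra xy => yO; apply/eqP.
exact: (alternating_orbit_fixed_uniq fK gK gw fw).
Qed.

(** Matching [x] with [y] would push the number of fixed points below its minimum [k]. *)
Lemma missed_not_adj f x y : avoids S f -> #|fixed f| = k -> x \notin S ->
  y \notin S -> f x = x -> f y = y -> ~~ adj x y.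
Proof.
move=> fS fk xS yS fx fy; apply/negP => xy.
have [fK ff fS'] := avoidsP _ _ fS.
have xy' : x != y by apply: contraTneq xy => ->; rewrite adj_irrefl.
pose f' := [ffun z => if z == x then y else if z == y then x else f z].
have f'S : avoids S f'.
  apply/avoidsP; split.
  - move=> z; rewrite !ffunE; have [->|zx] := eqVneq z x.
      by rewrite eqxx eq_sym (negPf xy').
    have [->|zy] := eqVneq z y; first by rewrite eqxx.
    rewrite !ifN ?fK //; first by rewrite -[X in _ != X]fy (inj_eq (inv_inj fK)).
    by rewrite -[X in _ != X]fx (inj_eq (inv_inj fK)).
  - move=> z; rewrite ffunE; case: eqP => [->|_]; first by right.
    by case: eqP => [->|_] //; right; rewrite adj_sym.
  move=> z zS; rewrite ffunE.
  rewrite ifN; last by apply: contraNneq xS => <-.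
  by rewrite ifN ?fS' //; apply: contraNneq yS => <-.
have := kmin f'S; rewrite -fk leqNgt => /negP; apply; apply: proper_card.
apply/properP; split; last by exists x; rewrite !inE ?fx // ffunE eqxx eq_sym.
apply/subsetP=> z; rewrite !inE ffunE.
have [->|_] := eqVneq z x; first by rewrite eq_sym (negPf xy').
by have [->|//] := eqVneq z y; rewrite (negPf xy').
Qed.

(** Induction along the path. If [f] saturates the second vertex [w], an exchange makes [w] missed
    together with its neighbour [x], which is impossible, or with the last vertex; then the last
    vertex is [w] by induction, but [f] misses it. *)
Lemma missed_not_connected (p : seq G) x f :
  path (@adj G) x p -> all (fun z => z \notin S) (x :: p) ->
  avoids S f -> #|fixed f| = k -> f x = x -> f (last x p) = last x p ->
  last x p = x.
Proof.
elim: p x f => //= w p IHp x f /andP[xw wp] /and3P[xS wS pS] fS fk fx fl.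
have wpS : all (fun z => z \notin S) (w :: p) by rewrite /= wS.
have [fw|fw] := eqVneq (f w) w.
  by have := missed_not_adj fS fk xS wS fx fw; rewrite xw.
have [<- //|xl] := eqVneq x (last w p).
have [f' [f'S f'k f'w]] := exchange fS fk wS fx fl xl fw.
case=> [f'x|f'l].
  by have := missed_not_adj f'S f'k xS wS f'x f'w; rewrite xw.
have lw := IHp w f' wp wpS f'S f'k f'w f'l.
by move: fw; rewrite -{1}lw fl lw eqxx.
Qed.

(** Of the [k] fixed points [#|S|] lie in [S]. The others lie in distinct components of [G - S],
    each of which is odd because [f] pairs up its remaining vertices. *)
Lemma fixed_le_odd_comp f : avoids S f -> #|fixed f| = k ->
  k - #|S| <= odd_comp (del_vertices S).
Proof.
move=> fS fk; have [fK ff fS'] := avoidsP _ _ fS.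
pose H := del_vertices S.
pose F : {set H} := [set x | f (val x) == val x].
pose comp (x : H) : {set H} := [set y in [set: H] | connect (@adj H) x y].
have -> : k - #|S| = #|F|.
  rewrite -fk; have -> : #|fixed f| = #|S| + #|F|; last by rewrite addKn.
  rewrite -(card_imset F val_inj) -(cardsID S); congr (_ + _); apply: eq_card => x.
    by rewrite !inE andbC; case: (boolP (x \in S)) => // /fS'->; rewrite eqxx.
  rewrite !inE; apply/andP/imsetP => [[xS fx]|[y]].
    by exists (Sub x xS); rewrite ?inE SubK.
  by rewrite inE => fy ->; split; first exact: valP y.
have conn (x y : H) : x \in F -> y \in F -> connect (@adj H) x y -> y = x.
  rewrite !inE => /eqP fx /eqP fy /connectP[p xp yE]; apply: val_inj.
  move: fy; rewrite {}yE -last_map => fl.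
  apply: missed_not_connected fS fk fx fl; first by rewrite path_map.
  by apply/allP=> z; rewrite -(map_cons val) => /mapP[z' _ ->]; apply: valP z'.
rewrite -(card_in_imset (f := comp)); last first.
  move=> x y Fx Fy xy; apply/esym/conn => //.
  have : y \in comp y by rewrite !inE connect0.
  by rewrite -xy !inE.
apply: subset_leq_card; apply/subsetP=> _ /imsetP[x Fx ->].
rewrite inE imset_f ?inE //=.
rewrite -(card_imset _ val_inj) -(odd_card_involution fK).
  suff -> : [set z in val @: comp x | f z == z] = [set val x] by rewrite cards1.
  apply/setP=> z; rewrite !inE; apply/andP/eqP => [[/imsetP[y yx ->]] fy|->].
    by congr val; apply: conn => //; move: yx; rewrite !inE.
  split; last by move: Fx; rewrite inE.
  by apply/imsetP; exists x; rewrite // !inE connect0.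
move=> _ /imsetP[y + ->]; rewrite !inE => xy.
have fyS : f (val y) \notin S.
  apply: contra (valP y) => fyS; have := fS' _ fyS; rewrite fK => ->.
  exact: fyS.
apply/imsetP; exists (Sub (f (val y)) fyS); last by rewrite SubK.
rewrite !inE; apply: connect_trans xy _.
have [fy|yfy] := ff (val y); last by apply: connect1; rewrite /= /del_adj SubK.
rewrite (_ : Sub _ _ = y) ?connect0 //.
by apply: val_inj; rewrite SubK.
Qed.

End Gallai.

Theorem tutte : (forall S, odd_comp (del_vertices S) <= #|S|) ->
  exists f : G -> G, involutive f /\ forall x, adj x (f x).
Proof.
move=> tutteS.
pose id_f : {ffun G -> G} := [ffun x => x].
have idS S : avoids S id_f.
  by apply/avoidsP; split=> [x|x|x _]; rewrite !ffunE //; left.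
have [f0 f0S f0min] := arg_minnP (fun f => #|fixed f|) (idS set0).
(* Deleting [S] lowers the matching number by at least [#|S|]; as the vertices of [S] count as
   fixed, this means [2 * #|S|] more fixed points. *)
pose P S := [forall f, avoids S f ==> (#|fixed f0| + 2 * #|S| <= #|fixed f|)].
have P0 : P set0.
  by apply/forall_inP=> f fS; rewrite cards0 addn0 f0min.
have [S /forall_inP PS Smax] := arg_maxnP (fun S : {set G} => #|S|) P0.
have missed w : w \notin S -> exists f,
    [/\ avoids S f, #|fixed f| = #|fixed f0| + 2 * #|S| & f w = w].
  move=> wS; have : ~~ P (w |: S).
    by apply/negP => /Smax; rewrite cardsU1 wS; clear; lia.
  rewrite negb_forall => /existsP[f]; rewrite negb_imply => /andP[fwS].
  rewrite cardsU1 wS -ltnNge => flt.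
  have [fK ff fS'] := avoidsP _ _ fwS.
  have fS : avoids S f by apply/avoidsP; split=> // x xS; apply: fS'; rewrite inE xS orbT.
  exists f; split=> //; last by apply: fS'; rewrite !inE eqxx.
  (* By [flt] the excess over [#|fixed f0|] is [2 * #|S|] or one more; parity excludes the
     latter. *)
  have := PS f fS; have := odd_fixed fS; have := odd_fixed f0S; move: flt.
  move: #|fixed f| #|fixed f0| #|S| => a b c; clear; lia.
suff f00 : #|fixed f0| = 0.
  have [fK ff _] := avoidsP _ _ f0S; exists f0; split=> // x.
  have [fx|//] := ff x; move/eqP: f00; rewrite cards_eq0 => /eqP/setP/(_ x).
  by rewrite !inE fx eqxx.
have [/eqP E|/set0Pn[w]] := boolP (~: S == set0).
  have := PS _ (idS S); have : #|fixed id_f| <= #|S|.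
    apply: subset_leq_card; apply/subsetP=> x _.
    by move/setP/(_ x): E; rewrite !inE => /negbFE.
  clear; lia.
rewrite inE => /missed[f [fS fk _]].
(* This reads [#|fixed f0| + #|S| <= odd_comp (del_vertices S) <= #|S|]. *)
have := fixed_le_odd_comp PS missed fS fk; have := tutteS S; clear; lia.
Qed.

End Tutte.

(** * Perfect matchings as involutions *)

Section Matchings.
Variable G : sgraph.
Implicit Types (S : {set G}) (M N : {set {set G}}) (x y z : G) (f : G -> G).

Lemma edgesP (e : {set G}) :
  reflect (exists x y, adj x y /\ e = [set x; y]) (e \in edges G).
Proof.
apply: (iffP imset2P) => [[x y _ xy ->]|[x [y [xy ->]]]]; first by exists x, y.
by exists x y.
Qed.

Lemma card_cover_matching M : matching M -> #|cover M| = #|M| * 2.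
Proof.
case/andP=> /subsetP ME /eqP<-; rewrite -sum_nat_const; apply: eq_bigr => e eM.
have /edgesP[x [y [xy ->]]] := ME e eM; rewrite cards2.
by case: eqVneq xy => // ->; rewrite adj_irrefl.
Qed.

Lemma perfect_maximum M : perfect_matching M -> maximum_matching M.
Proof.
case/andP=> MM /eqP cM; rewrite /maximum_matching MM; apply/forall_inP=> N NM.
have := card_cover_matching MM; have := card_cover_matching NM.
have : #|cover N| <= #|G| := max_card _; rewrite cM cardsT; clear; lia.
Qed.

Lemma maximum_perfect M N : perfect_matching N -> maximum_matching M ->
  perfect_matching M.
Proof.
case/andP=> NM /eqP cN /andP[MM /forall_inP/(_ N NM) NleM].
rewrite /perfect_matching MM eqEcard subsetT.
by rewrite (card_cover_matching MM) -cN (card_cover_matching NM) leq_mul2r NleM orbT.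
Qed.

Lemma perfect_matchingP M : perfect_matching M ->
  exists f, [/\ involutive f, forall x, adj x (f x) & M = mate_edges f].
Proof.
case/andP=> /andP[/subsetP ME tM] /eqP cM.
have exM x : exists y, [set x; y] \in M.
  have /bigcupP[e eM] : x \in cover M by rewrite cM.
  have /edgesP[a [b [_ eE]]] := ME e eM; rewrite eE in eM *.
  by case/set2P=> ->; [exists b | exists a; rewrite setUC].
have uniqM x y z : [set x; y] \in M -> [set x; z] \in M -> y = z.
  move=> xy xz; have E : [set x; y] = [set x; z].
    apply/eqP; apply: contraT => /(trivIsetP tM _ _ xy xz)/pred0P/(_ x) /=.
    by rewrite !set21.
  by case: (set2_eq E) => -[]; congruence.
pose f x := xchoose (exM x).
have fM x : [set x; f x] \in M := xchooseP (exM x).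
have fE x y : [set x; y] \in M -> f x = y by move=> xy; apply: uniqM xy.
exists f; split.
- by move=> x; apply: fE; rewrite setUC.
- move=> x; have /edgesP[a [b [ab /set2_eq[] [-> ->]]]] := ME _ (fM x) => //.
  by rewrite adj_sym.
apply/setP=> e; apply/idP/imsetP => [eM|[x _ ->] //].
have /edgesP[a [b [_ eE]]] := ME e eM; rewrite eE in eM *.
by exists a => //; rewrite (fE a b).
Qed.

(** An odd component is not matched within itself, so it contains the mate of a vertex of [S].
    Sending each vertex of [S] to the component of its mate, with [set0] if the mate is in [S],
    covers all odd components. *)
Lemma perfect_odd_comp f S : involutive f -> (forall x, adj x (f x)) ->
  odd_comp (del_vertices S) <= #|S|.
Proof.
move=> fK fadj; pose H := del_vertices S.
pose comp (x : H) : {set H} := [set y in [set: H] | connect (@adj H) x y].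
pose psi x : {set H} := if insub (f x) is Some y then comp y else set0.
apply: leq_trans (leq_imset_card psi S); apply: subset_leq_card.
apply/subsetP=> C; rewrite inE => /andP[/imsetP[x _ CE] oC].
have {}CE : C = comp x by [].
have [y yC fyS] : exists2 y, y \in C & f (val y) \in S.
  apply/exists_inP; apply: contraLR oC => /exists_inPn N.
  rewrite -(card_imset _ val_inj) -(odd_card_involution fK).
    rewrite (_ : [set _ in _ | _] = set0) ?cards0 //.
    by apply/setP=> z; rewrite !inE (negPf (mate_neq fadj z)) andbF.
  move=> _ /imsetP[y yC ->]; have fyS := N y yC.
  apply/imsetP; exists (Sub (f (val y)) fyS); last by rewrite SubK.
  move: yC; rewrite CE !inE /= => xy; apply: connect_trans xy (connect1 _).
  by rewrite /= /del_adj SubK.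
apply/imsetP; exists (f (val y)) => //; rewrite /psi fK valK.
move: yC; rewrite CE inE => /andP[_ xy]; apply/setP=> z; rewrite !inE /=.
have cs : connect_sym (@adj H) by apply: sym_connect_sym; apply: del_adj_sym.
by rewrite (same_connect cs xy).
Qed.

(** The set [R] reachable from [x] satisfies [nbhd R \subset f @: R], so it is not independent. An
    edge [y z] inside [R] makes both [z] and [f z] reachable, and reversing the walk to [f z] leads
    from [z] to [f x]. *)
Lemma linked_of_expansion f v : involutive f -> (forall x, adj x (f x)) ->
  (forall S, S != set0 -> independent S -> #|S| < #|nbhd S|) ->
  linked_vertex (@adj G) v.
Proof.
move=> fK fadj expand.
have half x : connect (astep (@adj G) f) x (f x).
  pose R := [set y | connect (astep (@adj G) f) x y].
  have xR : x \in R by rewrite inE connect0.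
  have RD y z : y \in R -> adj y z -> f z \in R.
    rewrite !inE => xy yz; apply: connect_trans xy (connect1 _).
    by rewrite /astep fK.
  have [/expand|] := boolP (independent R).
    have R0 : R != set0 by apply/set0Pn; exists x.
    move/(_ R0); rewrite ltnNge => /negP[].
    rewrite -(card_imset R (inv_inj fK)); apply: subset_leq_card.
    apply/subsetP=> u; rewrite inE => /exists_inP[y yR yu].
    by apply/imsetP; exists (f u); rewrite ?fK ?(RD y u).
  rewrite negb_forall_in => /exists_inP[y yR]; rewrite negb_forall_in.
  case/exists_inP=> z zR; rewrite negbK => yz.
  have fzR := RD y z yR yz; rewrite !inE in zR fzR.
  apply: connect_trans zR _.
  by have := connect_astep_rev (@adj_sym G) fK fzR; rewrite fK.
by exists f; split=> //; rewrite -{2}[v]fK.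
Qed.

Definition mate_closed f S : Prop :=
  [/\ involutive f, forall x, adj x (f x), independent S
    & forall x, (x \in nbhd S) = (f x \in S)].

Lemma mate_closed_of_card f S : involutive f -> (forall x, adj x (f x)) ->
  independent S -> #|nbhd S| <= #|S| -> mate_closed f S.
Proof.
move=> fK fadj iS le; split=> //.
have sub : f @: S \subset nbhd S.
  apply/subsetP=> _ /imsetP[x xS ->]; rewrite inE; apply/exists_inP.
  by exists x.
have /eqP <- : f @: S == nbhd S.
  by rewrite eqEcard sub (card_imset _ (inv_inj fK)).
by move=> x; rewrite -[x in LHS]fK (mem_imset _ _ (inv_inj fK)).
Qed.

(** * No Tposy meets an independent set whose mates form its neighbourhood *)

Section MateClosed.
Variables (f : G -> G) (S : {set G}).
Hypothesis fS : mate_closed f S.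
Local Notation M := (mate_edges f).
Local Notation B := (nbhd S).

Let fK : involutive f. Proof. by case: fS. Qed.
Let fadj x : adj x (f x). Proof. by case: fS. Qed.
Let fB x : (x \in B) = (f x \in S). Proof. by case: fS. Qed.

Lemma adj_nbhd x y : x \in S -> adj x y -> y \in B.
Proof. by move=> xS xy; rewrite inE; apply/exists_inP; exists x. Qed.

Lemma nbhd_disjoint x : x \in S -> x \notin B.
Proof.
move=> xS; rewrite inE; apply/exists_inP => -[y yS yx].
case: fS => _ _ /forall_inP/(_ y yS)/forall_inP/(_ x xS) + _.
by rewrite yx.
Qed.

(** The [k] disjoint matching edges of the blossom avoid [b], so by counting they cover the other
    [2k] vertices. *)
Lemma blossom_mate c b : blossom M c b ->
  {in c, forall x, x != b -> f x \in c /\ f x != b}.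
Proof.
case/and5P=> cA cU c2 oc /and3P[/eqP cM bc bN] x xc xb.
set E := cycle_edges c :&: M in cM bN.
have EM : matching E.
  have /andP[/subsetP ME tM] := mate_edges_matching fK fadj.
  apply/andP; split; last by apply: trivIsetS tM; apply: subsetIr.
  by apply/subsetP=> e /setIP[_ /ME].
have Ec : cover E \subset [set y in c] :\ b.
  apply/subsetP=> y yE; rewrite !inE; apply/andP; split.
    by apply: contraNneq bN => <-.
  case/bigcupP: yE => e /setIP[/cycle_edges_subset/subsetP ec _] ye.
  exact: ec.
have cE : cover E = [set y in c] :\ b.
  apply/eqP; rewrite eqEcard Ec card_cover_matching // cM muln2.
  have := cardsD1 b [set y in c]; rewrite inE bc.
  have -> : #|[set y in c]| = size c.
    by rewrite -(card_uniqP cU); apply: eq_card => y; rewrite inE.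
  have := odd_double_half (size c); rewrite oc; clear; lia.
have /bigcupP[e eE xe] : x \in cover E by rewrite cE !inE xb.
have fxe : f x \in e.
  case/setIP: (eE) => _ /imsetP[y _ ey]; move: xe; rewrite ey.
  by case/set2P=> ->; rewrite ?fK ?set21 ?set22.
have : f x \in cover E by apply/bigcupP; exists e.
by rewrite cE !inE => /andP[-> ->].
Qed.

(** On the cycle, [next] maps [S] into [nbhd S], and [f] maps [nbhd S] minus [b] back into [S] minus
    [b]; this rules out [b] in [S] by counting. If [b] were not in [nbhd S] either, the counts would
    agree and [Sc :|: Bc] would be closed under [next], hence contain [b]. *)
Lemma blossom_base c b : blossom M c b ->
  b \notin S /\ {in c, forall x, x \in S -> b \in B}.
Proof.
move=> bl; have mate := blossom_mate bl.
case/and5P: bl => cA cU c2 oc /and3P[_ bc _].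
pose Sc := [set x in c | x \in S]; pose Bc := [set x in c | x \in B].
have nSB : next c @: Sc \subset Bc.
  apply/subsetP=> _ /imsetP[x + ->]; rewrite in_set => /andP[xc xS].
  by rewrite in_set mem_next xc (adj_nbhd xS) // next_cycle.
have nI : injective (next c) := can_inj (prev_next cU).
have SleB : #|Sc| <= #|Bc| by rewrite -(card_imset _ nI) subset_leq_card.
have bNS : b \notin S.
  apply/negP => bS; have : f @: Bc \subset Sc :\ b.
    apply/subsetP=> _ /imsetP[x + ->]; rewrite in_set => /andP[xc xB].
    have xb : x != b by apply: contraTneq xB => ->; apply: nbhd_disjoint.
    have [fxc fxb] := mate x xc xb.
    by rewrite in_setD1 fxb in_set fxc -fB.
  move/subset_leq_card; rewrite (card_imset _ (inv_inj fK)).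
  have := cardsD1 b Sc; rewrite in_set bc bS; move: SleB; clear; lia.
split=> // x xc xS; apply: contraT => bNB.
have BleS : #|Bc| <= #|Sc|.
  rewrite -(card_imset Bc (inv_inj fK)); apply: subset_leq_card.
  apply/subsetP=> _ /imsetP[y + ->]; rewrite in_set => /andP[yc yB].
  have yb : y != b by apply: contraTneq yB => ->.
  by have [fyc _] := mate y yc yb; rewrite in_set fyc -fB.
have /eqP nE : next c @: Sc == Bc.
  by rewrite eqEcard nSB (card_imset _ nI).
(* The same count for [prev] shows that the successor of each vertex of [Bc] is in [Sc]. *)
have pE : prev c @: Sc = Bc.
  have pI : injective (prev c) := can_inj (next_prev cU).
  apply/eqP; rewrite eqEcard (card_imset _ pI) BleS andbT.
  apply/subsetP=> _ /imsetP[y + ->]; rewrite in_set => /andP[yc yS].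
  by rewrite in_set mem_prev yc (adj_nbhd yS) // adj_sym prev_cycle.
have closed y : y \in Sc :|: Bc -> next c y \in Sc :|: Bc.
  case/setUP=> [yS|]; first by apply/setUP; right; rewrite -nE; apply: imset_f.
  by rewrite -{1}pE => /imsetP[z zS ->]; rewrite next_prev // in_setU zS.
have : fconnect (next c) x b.
  by rewrite (fconnect_cycle (cycle_next cU) xc).
move/iter_findex; move: (findex _ _ _) => n nb.
have : iter n (next c) x \in Sc :|: Bc.
  elim: n {nb} => [|n IHn]; last exact: closed.
  by rewrite in_setU in_set xc xS.
by rewrite nb in_setU in_set (negPf bNS) in_set (negPf bNB) !andbF.
Qed.

Let alt : rel {set G} := fun e e' => (e \in M) (+) (e' \in M).

(** Matching edges lead from [nbhd S] to [S] and other edges from [S] to [nbhd S], so alternation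
    preserves the condition up to the final matching edge. *)
Lemma alternating_last x p :
  path (@adj G) x p -> sorted alt (path_edges x p) -> p != [::] ->
  last set0 (path_edges x p) \in M ->
  (if head set0 (path_edges x p) \in M then x \in B else x \in S) ->
  last x p \in S.
Proof.
elim: p x => [//|y p IHp] x /= /andP[xy yp] sM _ lM.
have ME z w : ([set z; w] \in M) = (w == f z) by apply: mem_mate_edges.
case: p IHp yp sM lM => [|z p] IHp yp sM lM.
  move: lM => /= lM; rewrite lM fB; move: lM.
  by rewrite ME => /eqP->.
have [sM1 sM2] : alt [set x; y] [set y; z] /\ sorted alt (path_edges y (z :: p)).
  by apply/andP.
move=> H; apply: IHp => //=.
move: sM1 H; rewrite /alt ME; case: eqP => [->|_] /=.
  by move/negPf=> ->; rewrite fB.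
by move=> -> xS; apply: adj_nbhd xy.
Qed.

(** Membership of [z] in [S] propagates forward to the end if the edge before [z] is a matching
    edge, and otherwise backward to the start. *)
Lemma alternating_mem x p z :
  path (@adj G) x p -> sorted alt (path_edges x p) ->
  last set0 (path_edges x p) \in M -> z \in p -> z \in S ->
  last x p \in S \/
  (if head set0 (path_edges x p) \in M then x \in S else x \in B).
Proof.
elim: p x => [//|y p IHp] x /= /andP[xy yp] sM lM.
have ME u w : ([set u; w] \in M) = (w == f u) by apply: mem_mate_edges.
have toB : y \in S -> x \in B by move=> yS; apply: (adj_nbhd yS); rewrite adj_sym.
case: p IHp yp sM lM => [|w p] IHp yp sM lM.
  by rewrite inE => /eqP-> yS; left.
have [sM1 sM2] : alt [set x; y] [set y; w] /\ sorted alt (path_edges y (w :: p)).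
  by apply/andP.
rewrite inE => /predU1P[->|zp] zS.
  have [xyM|xyM] := boolP ([set x; y] \in M); last by right; apply: toB.
  left; apply: (alternating_last yp) => //=.
  by move: sM1; rewrite /alt xyM /= => /negPf->.
have [|yH] := IHp y yp sM2 lM zp zS; first by left.
right; move: sM1 yH; rewrite /alt ME /=; case: eqP => [->|_] /=.
  by move=> /negPf->; rewrite fB fK.
by move=> ->; apply: toB.
Qed.

Lemma mate_last_mem x p : p != [::] -> last set0 (path_edges x p) \in M ->
  f (last x p) \in x :: p.
Proof.
elim: p x => [//|y p IHp] x _ /=.
case: p IHp => [_|z p IHp lM].
  by rewrite /= mem_mate_edges // => /eqP->; rewrite fK mem_head.
by rewrite inE IHp ?orbT.
Qed.

(** As the bases are not in [S], neither is any vertex of the mm-path. A vertex of [S] on the first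
    blossom puts [b1] into [nbhd S] and thus [b2] into [S]; one on the second puts the mate of [b2],
    a vertex of the path, into [S]. *)
Lemma in_tposy_mate_closed v : in_tposy M v -> v \notin S.
Proof.
case=> c1 [b1 [c2 [b2 [p [[bl1 bl2 [mm lp] _ _] vT]]]]].
have [b1S B1] := blossom_base bl1; have [b2S B2] := blossom_base bl2.
case/and4P: mm => /andP[/andP[pA _] sM] p0 hM lM.
have path_N z : z \in b1 :: p -> z \notin S.
  rewrite inE => /predU1P[->//|zp]; apply/negP=> zS.
  have := alternating_mem pA sM lM zp zS; rewrite hM lp.
  by rewrite (negPf b1S) (negPf b2S); case.
apply/negP=> vS; case/or3P: vT => [vc|vc|/path_N/negP//].
  have b1B := B1 v vc vS.
  by have := alternating_last pA sM p0 lM; rewrite hM lp (negPf b2S) => /(_ b1B).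
have b2B := B2 v vc vS; rewrite fB -lp in b2B.
by have /negP := path_N _ (mate_last_mem p0 lM).
Qed.

End MateClosed.

End Matchings.

(** * The equivalence *)

Theorem theorem3p5 (G : sgraph) :
  (sterboul_deming G /\ has_perfect_matching G) <->
  ((forall S : {set G}, S != set0 -> independent S -> #|S| < #|nbhd S|) /\
   (forall S : {set G}, odd_comp (del_vertices S) <= #|S|)).
Proof.
split=> [[SDG [N NP]]|[expand tutteG]].
  have [f [fK fadj _]] := perfect_matchingP NP.
  split=> S; last exact: perfect_odd_comp fK fadj.
  case/set0Pn=> v vS iS; rewrite ltnNge; apply/negP => le.
  have : v \in SD G.
    by move/setP/(_ v): SDG; rewrite !inE => /negbFE.
  rewrite inE => /asboolP[M /(maximum_perfect NP) MP].
  have [g [gK gadj ME]] := perfect_matchingP MP.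
  (* A stem would have to end at an unsaturated vertex, so a perfect matching has no Tflower. *)
  case=> [[c [b [p [[_ /and3P[_ _ +] _] _]]]]|].
    by case/andP: MP => _ /eqP->; rewrite inE.
  rewrite ME => /(in_tposy_mate_closed (mate_closed_of_card gK gadj iS le)).
  by rewrite vS.
have [f [fK fadj]] := tutte tutteG.
split; last by exists (mate_edges f); apply: mate_edges_perfect.
apply/setP=> v; rewrite !inE; apply/negbTE; rewrite negbK; apply/asboolP.
have lv := linked_of_expansion v fK fadj expand.
have [g [gK gadj gT]] := in_tposy_linked (@adj_sym G) (fun _ _ => id) lv.
exists (mate_edges g); last by right.
by apply/perfect_maximum/mate_edges_perfect.
Qed.
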